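(* Fix a real $\theta>0$. Let $(\tau,X)$ be a dashed pattern of size $p$, let $q=|X|$, and let $(\sigma_N)_{N\ge1}$ be a sequence of random Ewens permutations with parameter $\theta$, $\sigma_N$ being of size $N$. Then $\frac{O^{(N)}_{\tau,X}(\sigma_N)}{N^{p-q}}$ tends almost surely, as $N\to\infty$, towards $\frac{1}{p!\,(p-q)!}$. Besides, there exists a nonnegative real number $V_{\tau,X}$ such that $$Z^{(N)}_{(X,\tau)}:=\sqrt{N}\left(\frac{O^{(N)}_{\tau,X}(\sigma_N)}{N^{p-q}}-\frac{1}{p!\,(p-q)!}\right)\longrightarrow\mathcal{N}(0,V_{\tau,X})$$ in distribution as $N\to\infty$.
   Context: For $\theta>0$, the Ewens measure on the symmetric group $S_N$ is $\mu_N(\{\sigma\})=\frac{\theta^{\#(\sigma)}}{\theta(\theta+1)\cdots(\theta+N-1)}$, where $\#(\sigma)$ is the number of cycles of $\sigma$. A random Ewens permutation of size $N$ is a random element of $S_N$ with law $\mu_N$. For the almost sure statement, the permutations $\sigma_N$ ($N\ge1$) are defined on a common probability space, with arbitrary joint law. A dashed pattern of size $p\ge1$ is a pair $(\tau,X)$ where $\tau\in S_p$ and $X\subseteq[p-1]=\{1,\dots,p-1\}$. An occurrence of $(\tau,X)$ in $\sigma\in S_N$ is a list $i_1<\dots<i_p$ of elements of $[N]$ such that: for any $x\in X$, $i_{x+1}=i_x+1$; and $\sigma(i_1),\dots,\sigma(i_p)$ is in the same relative order as $\tau(1),\dots,\tau(p)$. The number of occurrences of $(\tau,X)$ in $\sigma$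 is denoted $O^{(N)}_{\tau,X}(\sigma)$. $\mathcal{N}(0,V)$ is the centered normal law with variance $V$ (the Dirac mass at $0$ if $V=0$). *)

(* Defs.v *)
From HB Require Import structures.
From mathcomp Require Import all_boot all_order all_algebra all_fingroup.
From mathcomp Require Import all_classical all_reals all_analysis.

Set Implicit Arguments.
Unset Strict Implicit.
Unset Printing Implicit Defensive.

Import Order.TTheory GRing.Theory Num.Theory.
Import numFieldNormedType.Exports.

Local Open Scope classical_set_scope.
Local Open Scope ring_scope.

(* [porbits s] is the set of all cycles of [s], fixed points included. *)
Definition ewens_weight (R : realType) (theta : R) (N : nat) (s : 'S_N) : R :=
  theta ^+ #|porbits s| / \prod_(i < N) (theta + i%:R).

(* Measurability is with respect to the discrete sigma-algebra on ['S_N]. *)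
Definition ewens_permutation (R : realType) (d : measure_display)
    (T : measurableType d) (P : probability T R) (theta : R) (N : nat)
    (sigma : T -> 'S_N) : Prop :=
  (forall A : set 'S_N, measurable (sigma @^-1` A)) /\
  (forall s : 'S_N, P (sigma @^-1` [set s]) = (ewens_weight theta s)%:E).

(* A dashed pattern of size [p] is given by [tau : 'S_p] and
   [X : {set 'I_p.-1}].  Everything is numbered from 0: the element [x] of
   ['I_p.-1] stands for [x.+1] in {1, ..., p - 1}, so it links the 0-based
   positions [x] and [x.+1] of the list. *)
Definition is_occurrence (p : nat) (tau : 'S_p) (X : {set 'I_p.-1}) (N : nat)
    (s : 'S_N) (l : p.-tuple 'I_N) : bool :=
  [&& [forall j : 'I_p, forall k : 'I_p,
         (j < k)%N ==> (tnth l j < tnth l k)%N],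
      [forall x : 'I_p.-1, forall j : 'I_p, forall k : 'I_p,
         [&& x \in X, j == x :> nat & k == x.+1 :> nat] ==>
           (tnth l k == (tnth l j).+1 :> nat)] &
      [forall j : 'I_p, forall k : 'I_p,
         (s (tnth l j) < s (tnth l k))%N == (tau j < tau k)%N]].

Definition occurrences (p : nat) (tau : 'S_p) (X : {set 'I_p.-1}) (N : nat)
    (s : 'S_N) : nat :=
  #|[pred l : p.-tuple 'I_N | is_occurrence tau X s l]|.

(* The library's [normal_prob m s] takes the standard deviation [s], and for
   [s = 0] it is the uniform law on [0, 1] rather than a Dirac mass. *)
Definition centered_normal (R : realType) (V : R) :
    probability (measurableTypeR R) R :=
  if V == 0 then (\d_(0 : measurableTypeR R) : probability _ R)
  else (normal_prob 0 (Num.sqrt V) : probability _ R).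

Definition cvg_in_distribution (R : realType) (d : measure_display)
    (T : measurableType d) (P : probability T R) (Z : nat -> T -> R)
    (mu : probability (measurableTypeR R) R) : Prop :=
  (forall N : nat, measurable_fun setT (Z N)) /\
  (forall f : R -> R, continuous f -> bounded_fun f ->
     (\int[P]_w (f (Z N w))%:E)%E @[N --> \oo] --> (\int[mu]_x (f x)%:E)%E).

(* Main.v *)
(** Under the uniform law on ['S_N], the relative order at a set of positions is
    independent of the relative orders at positions disjoint from it.  So the
    centered number of occurrences is a sum of about [N ^ r] bounded variables
    ([r = p - q]) with a dependency graph of degree [O(N ^ r.-1)].  Stein's
    identity for dependency graphs gives the normal limit: every test function
    [h] is corrected into a function whose Stein solution has compact support,
    so that only the uniform continuity of its derivative is needed.  The
    variance converges because the covariance of two occurrences depends only on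
    the shape of their overlap, and the number of overlaps of a given shape is a
    binomial coefficient.

    An Ewens permutation is a product of [N] independent transpositions whose
    law at step [k] is at distance [O(1 / k)] from that of a uniform
    permutation.  Hence a positive functional that changes by a factor at most
    [1 + delta] when the permutation is modified at three points has an Ewens
    mean at most [exp (O(delta * log N))] times its uniform mean.  This transfers
    the limit law ([delta = O(1 / sqrt N)]) and a fourth moment bound, which
    yields the almost sure convergence by summability. *)
Require Import Defs.
From HB Require Import structures.
From mathcomp Require Import all_boot all_order all_algebra all_fingroup.
From mathcomp Require Import zify ring lra.

Set Implicit Arguments.
Unset Strict Implicit.
Unset Printing Implicit Defensive.

Import Order.TTheory GRing.Theory Num.Theory.

Local Open Scope ring_scope.

(** The comparison with the uniform law is multiplicative and one-sided, whereas a limit law needs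
    additive, two-sided control. A test function [h] bounded by [B] therefore enters through
    [B + 1 + h] and [B + 1 - h], both at least 1. The harmonic sum behind [log N] is bounded by
    [4 * N ^ (1/4)], which still leaves an exponent [O(N ^ (-1/4))].

    Two classes of test functions compete: the compactly supported ones, for which Stein's equation
    is solved, and the Lipschitz ones, which vary little when the permutation changes at three
    points. Truncation by plateaus and inf-convolution connect these classes and reach all bounded
    continuous functions.

    The limiting variance is never computed. It is the limit of the rescaled second moment under the
    uniform law, hence the same for every [theta], and it may vanish. Stein's equation is used for a
    positive variance; the case [V = 0] follows from the second moment alone. *)

(** * Relative orders and their uniformity *)

Section Standardization.
Variables (m N : nat).
Implicit Types (u : 'I_m -> 'I_N).

Lemma std_subproof u (j : 'I_m) : (#|[pred k | (u k < u j)%N]| < m)%N.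
Proof.
rewrite -[X in (_ < X)%N]card_ord; apply: proper_card; apply/properP.
by split; [exact/subsetP | exists j; rewrite // inE ltnn].
Qed.

Definition std_fun u (j : 'I_m) : 'I_m := Ordinal (std_subproof u j).

Lemma std_fun_lt u (i j : 'I_m) : (u i < u j)%N -> (std_fun u i < std_fun u j)%N.
Proof.
move=> ij; apply: proper_card; apply/properP; split.
  by apply/subsetP => k; rewrite !inE => /ltn_trans; apply.
by exists i; rewrite !inE // ltnn.
Qed.

Lemma std_fun_inj u : injective u -> injective (std_fun u).
Proof.
move=> u_inj i j e; apply: u_inj; apply/val_inj => /=.
by case: (ltngtP (u i) (u j)) => // /std_fun_lt; rewrite e ltnn.
Qed.

Definition std u (u_inj : injective u) : 'S_m := perm (std_fun_inj u_inj).

Lemma std_lt u (u_inj : injective u) i j :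
  (std u_inj i < std u_inj j)%N = (u i < u j)%N.
Proof.
rewrite !permE; case: (ltngtP (u i) (u j)) => [/std_fun_lt //|/std_fun_lt|].
  by move=> h; apply/negbTE; rewrite -leqNgt ltnW.
by move=> /val_inj/u_inj ->; rewrite ltnn.
Qed.

(** Ranks depend only on the set of values; [rho] keeps this set and permutes the indices. *)
Lemma std_comp u (u_inj : injective u) (rho : 'S_m) v (v_inj : injective v) :
  v =1 u \o rho -> std v_inj = (rho * std u_inj)%g.
Proof.
move=> uv; apply/permP => j; rewrite permM !permE; apply/val_inj => /=.
rewrite -(card_image (@perm_inj _ rho)); apply: eq_card => k.
by rewrite -[k](permKV rho) mem_image ?inE ?uv //=; exact: perm_inj.
Qed.

End Standardization.

Section PermutationExtension.
Variables (m N : nat) (J : 'I_m -> 'I_N).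
Hypothesis J_inj : injective J.

Definition ext_fun (rho : 'S_m) (x : 'I_N) : 'I_N :=
  if [pick k | J k == x] is Some k then J (rho k) else x.

Lemma ext_funE rho k : ext_fun rho (J k) = J (rho k).
Proof.
rewrite /ext_fun; case: pickP => [k' /eqP/J_inj -> //|/(_ k)].
by rewrite eqxx.
Qed.

Lemma ext_fun_out rho x : (forall k, J k != x) -> ext_fun rho x = x.
Proof.
by rewrite /ext_fun => h; case: pickP => // k; rewrite (negbTE (h k)).
Qed.

Lemma ext_fun_cancel rho : cancel (ext_fun rho) (ext_fun rho^-1%g).
Proof.
move=> x; have [/existsP[k /eqP <-]|] := boolP [exists k, J k == x].
  by rewrite !ext_funE permK.
by rewrite negb_exists => /forallP h; rewrite !ext_fun_out.
Qed.

(** In [ext rho * s] the left factor acts first, so it moves positions and keeps the set of values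
    that [s] takes on the image of [J]. *)
Definition ext rho : 'S_N := perm (can_inj (ext_fun_cancel rho)).

Lemma extE rho k : ext rho (J k) = J (rho k).
Proof. by rewrite permE ext_funE. Qed.

Lemma ext_out rho x : (forall k, J k != x) -> ext rho x = x.
Proof. by move=> h; rewrite permE ext_fun_out. Qed.

Lemma inj_perm_comp (s : 'S_N) : injective (s \o J).
Proof. by apply: inj_comp => //; exact: perm_inj. Qed.

(** The relative order of [s] on the positions listed by [J]. *)
Definition pat (s : 'S_N) : 'S_m := std (@inj_perm_comp s).

Lemma pat_ext rho s : pat (ext rho * s)%g = (rho * pat s)%g.
Proof. by apply: std_comp => k /=; rewrite permM extE. Qed.

(* Averaging over the relabellings [ext rho] of the positions in the image of
   [J] makes the relative order on these positions uniform, whatever [G] is. *)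
Lemma sum_pat_indep (R : numFieldType) (Phi : 'S_m -> R) (G : 'S_N -> R) :
    (forall rho s, G (ext rho * s)%g = G s) ->
  \sum_s Phi (pat s) * G s = (\sum_t Phi t) / m`!%:R * \sum_s G s.
Proof.
move=> hG; have m0 : m`!%:R != 0 :> R by rewrite pnatr_eq0 -lt0n fact_gt0.
apply: (mulfI m0); rewrite mulrA [_ * (_ / _)]mulrC divfK //.
rewrite -{1}card_Sn -sum1_card natr_sum big_distrl /=.
transitivity (\sum_(rho : 'S_m) \sum_s Phi (rho * pat s)%g * G s).
  rewrite (eq_bigl (fun=> true)); last by move=> s; rewrite inE.
  apply: eq_bigr => rho _; rewrite mul1r (reindex_inj (mulgI (ext rho))) /=.
  by apply: eq_bigr => s _; rewrite pat_ext hG.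
rewrite exchange_big big_distrr /=; apply: eq_bigr => s _.
by rewrite -big_distrl /= [in RHS](reindex_inj (mulIg (pat s))).
Qed.

End PermutationExtension.

(** * Counting lists of positions with prescribed adjacencies *)

(** The part of [is_occurrence] that concerns positions only. The set [G] is arbitrary because the
    union of two occurrences carries adjacencies of its own. *)
Definition admissible m N (G : {set 'I_m.-1}) (l : m.-tuple 'I_N) : bool :=
  [forall j : 'I_m, forall k : 'I_m, (j < k)%N ==> (tnth l j < tnth l k)%N] &&
  [forall x : 'I_m.-1, forall j : 'I_m, forall k : 'I_m,
     [&& x \in G, j == x :> nat & k == x.+1 :> nat] ==>
       (tnth l k == (tnth l j).+1 :> nat)].

Section Counting.
Local Open Scope nat_scope.

Definition gap (b : bool) (u v : nat) := if b then v == u.+1 else u < v.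

(** Recursive form of admissibility. The adjacencies are a predicate on all of [nat], so that it can
    be shifted along the list. *)
Fixpoint chain (g : nat -> bool) (v : nat) (s : seq nat) : bool :=
  if s is u :: s' then gap (g 0) v u && chain (g \o succn) u s' else true.

Lemma chainP g v s :
  reflect (forall k, k < size s -> gap (g k) (nth 0 (v :: s) k) (nth 0 s k))
          (chain g v s).
Proof.
elim: s g v => [|u s IHs] g v /=; first by apply: ReflectT.
apply: (iffP andP) => [[gvu /IHs h] [|k] //= ks|h]; first exact: h.
by split; [exact: (h 0) | apply/IHs => k ks; exact: (h k.+1)].
Qed.

Lemma big_tuple_cons N m (F : m.+1.-tuple 'I_N -> nat) :
  \sum_l F l = \sum_u \sum_(l : m.-tuple 'I_N) F [tuple of u :: l].
Proof.
rewrite pair_big /= (reindex (fun ul : 'I_N * m.-tuple 'I_N => [tuple of ul.1 :: ul.2])) //=.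
exists (fun l : m.+1.-tuple 'I_N => (thead l, [tuple of behead l])).
  by move=> [u l] _ /=; congr (_, _); apply/val_inj.
by move=> l _; rewrite /= -tuple_eta.
Qed.

(** The hockey-stick identity. The guard matters for [k = 0]: truncated subtraction would otherwise
    add a term ['C(0, 0)] for each [u] too close to [N]. *)
Lemma sum_bin_above N q k v : v < N ->
  \sum_(u < N | v < u) (if u + q < N then 'C(N - u.+1 - q, k) else 0) =
  'C(N - v.+1 - q, k.+1).
Proof.
move=> vN; have [n ->] : exists n, N = v + n.+1 by exists (N - v.+1); lia.
clear N vN; elim: n v => [|n IHn] v.
  rewrite big_pred0; first by rewrite addn1 subnn sub0n bin0n.
  by move=> u; have := ltn_ord u; lia.
have lt : v.+1 < v + n.+2 by lia.
rewrite (bigD1 (Ordinal lt)) //=.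
rewrite (eq_bigl (fun u : 'I_(v + n.+2) => v.+1 < u)); last first.
  by move=> u; rewrite -(inj_eq val_inj) /=; lia.
rewrite -addSnnS IHn; case: ifP => h.
  have -> : v.+1 + n.+1 - v.+1 - q = (v.+1 + n.+1 - v.+2 - q).+1 by lia.
  by rewrite binS addnC.
have [-> ->] : v.+1 + n.+1 - v.+1 - q = 0 /\ v.+1 + n.+1 - v.+2 - q = 0 by lia.
by rewrite !bin0n.
Qed.

Lemma count_le_size g m : count g (iota 0 m) <= m.
Proof. by rewrite -[X in _ <= X](size_iota 0) count_size. Qed.

Lemma count_iotaS g m : count g (iota 0 m.+1) = g 0 + count (g \o succn) (iota 0 m).
Proof. by rewrite /= -add1n iotaDl count_map; congr (_ + _); apply: eq_count. Qed.

(** Contracting the [q] forced gaps leaves [m - q] free elements, to be chosen among [N - v.+1 - q]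
    positions above [v]. *)
Lemma card_chain_from N g m v (q := count g (iota 0 m)) : v < N ->
  \sum_(l : m.-tuple 'I_N | chain g v (map val l)) 1 =
  if v + q < N then 'C(N - v.+1 - q, m - q) else 0.
Proof.
rewrite {}/q; elim: m g v => [|m IHm] g v vN.
  rewrite (eq_bigl xpredT) => [|l]; last by rewrite tuple0.
  by rewrite sum1_card card_tuple expn0 /= addn0 vN bin0.
rewrite count_iotaS big_mkcond big_tuple_cons /=.
set q := count (g \o succn) (iota 0 m).
have q_le : q <= m by exact: count_le_size.
rewrite (eq_bigr (fun u : 'I_N => if gap (g 0) v u then
    (if u + q < N then 'C(N - u.+1 - q, m - q) else 0) else 0)); last first.
  move=> u _; rewrite -IHm //.
  by case: (gap _ _ _); rewrite /= -?big_mkcond // big1.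
rewrite -big_mkcond /= /gap; case: (g 0) => /=.
  rewrite add1n; case: (ltnP v.+1 N) => v1N; last first.
    rewrite big_pred0 ?ifF //; first by lia.
    by move=> u; have := ltn_ord u; lia.
  rewrite (big_pred1 (Ordinal v1N)) /=; last by move=> u; rewrite -[RHS](inj_eq val_inj).
  by rewrite -addSnnS; congr (if _ then 'C(_, _) else _); lia.
rewrite add0n sum_bin_above //; case: ifP => h; first by rewrite subSn.
by have -> : N - v.+1 - q = 0 by lia.
Qed.

Lemma card_chain N g m (q := count g (iota 0 m)) :
  \sum_(l : m.+1.-tuple 'I_N | chain g (head 0 (map val l)) (behead (map val l))) 1 =
  'C(N - q, m.+1 - q).
Proof.
rewrite big_mkcond big_tuple_cons /=.
have q_le : q <= m by exact: count_le_size.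
under eq_bigr => v _ do rewrite -big_mkcond (card_chain_from _ _ (ltn_ord v)).
case: N => [|N]; first by rewrite big_ord0 sub0n bin0n; case: (m.+1 - q) (subSn q_le).
rewrite -/q.
(* The first element is unconstrained: shifting the positions by one puts it strictly above a
   virtual start at 0. *)
have := @sum_bin_above N.+2 q (m - q) 0 isT.
rewrite (subSn q_le) (_ : N.+2 - 1 = N.+1) // => <-.
rewrite [RHS]big_mkcond [RHS]big_ord_recl /= add0n.
by apply: eq_bigr => u _; rewrite /bump /= add1n subSS addSn ltnS.
Qed.

Definition flag m (G : {set 'I_m}) (k : nat) : bool := [exists x in G, x == k :> nat].

Lemma count_flag m (G : {set 'I_m}) : count (flag G) (iota 0 m) = #|G|.
Proof.
rewrite -val_enum_ord count_map cardE enumT -size_filter.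
congr (size _); apply: eq_filter => x /=; apply/existsP/idP => [[y]|xG].
  by case/andP => yG /eqP/val_inj <-.
by exists x; rewrite [x \in G]xG /=.
Qed.

(** A chain compares consecutive entries only; [mono] recovers the order of all pairs by
    transitivity. *)
Lemma admissible_chain m N (G : {set 'I_m}) (l : m.+1.-tuple 'I_N) :
  admissible (m := m.+1) G l =
  chain (flag G) (head 0 (map val l)) (behead (map val l)).
Proof.
have hs : size (map val l) = m.+1 by rewrite size_map size_tuple.
have nthE (j : 'I_m.+1) : nth 0 (map val l) j = tnth l j.
  by rewrite (nth_map (tnth l j)) ?size_tuple // -tnth_nth.
have hcons : head 0 (map val l) :: behead (map val l) = map val l.
  by case: (map val l) hs.
have nthS k : nth 0 (behead (map val l)) k = nth 0 (map val l) k.+1.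
  by rewrite nth_behead.
apply/andP/chainP => [[/forallP inc /forallP adj] k|h].
  rewrite size_behead hs /= => km; rewrite hcons nthS.
  have km1 : k < m.+1 by lia.
  rewrite (nthE (Ordinal km1)) (nthE (Ordinal (km : k.+1 < m.+1))) /gap.
  case: ifP => [/existsP[x /andP[xG /eqP xk]]|_].
    have /forallP/(_ (Ordinal km1))/forallP/(_ (Ordinal (km : k.+1 < m.+1))) := adj x.
    by rewrite xG /= xk !eqxx /= => /eqP ->.
  have /forallP/(_ (Ordinal (km : k.+1 < m.+1)))/implyP := inc (Ordinal km1).
  exact.
have {}h k : k < m -> gap (flag G k) (nth 0 (map val l) k) (nth 0 (map val l) k.+1).
  by move=> km; have := h k; rewrite hcons nthS size_behead hs; apply.
have step k : k < m -> nth 0 (map val l) k < nth 0 (map val l) k.+1.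
  by move=> /h; rewrite /gap; case: ifP => // _ /eqP ->.
have mono j d : j + d.+1 < m.+1 -> nth 0 (map val l) j < nth 0 (map val l) (j + d.+1).
  elim: d => [|d IHd] jd; first by rewrite addn1; apply: step; lia.
  by rewrite addnS; apply: (ltn_trans (IHd _) (step _ _)); lia.
split; apply/forallP => j; apply/forallP => k.
  apply/implyP => jk; rewrite -!nthE.
  have -> : nat_of_ord k = j + (k - j.+1).+1 by lia.
  by apply: mono; have := ltn_ord k; lia.
apply/forallP => i; apply/implyP => /and3P[jG /eqP kj /eqP ij].
have := h j (ltn_ord j); rewrite /gap ifT; last by apply/existsP; exists j; rewrite jG /=.
by rewrite -ij -kj !nthE.
Qed.

Lemma card_admissible m N (G : {set 'I_m.-1}) : 0 < m ->
  \sum_(l : m.-tuple 'I_N | admissible G l) 1 = 'C(N - #|G|, m - #|G|).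
Proof.
case: m G => // m G _; rewrite -count_flag -card_chain.
by apply: eq_bigl => l; rewrite admissible_chain.
Qed.

End Counting.

(** * Lists through a given point, and the degree of the dependency graph *)

Section Degree.
Local Open Scope nat_scope.
Variables (m N : nat) (G : {set 'I_m}).

(** A block is a maximal run of positions linked by [G], and a position starts one unless [G] links
    it to its predecessor. The values at the starts determine the list, so their number is the
    exponent of [N] in all counts. *)
Definition block_starts : {set 'I_m.+1} := ~: [set lift ord0 x | x in G].

Lemma card_block_starts : #|block_starts| = m.+1 - #|G|.
Proof. by rewrite cardsCs setCK card_imset ?card_ord //; exact: lift_inj. Qed.

Lemma notin_block_starts (j : 'I_m.+1) :
  j \notin block_starts -> exists2 x : 'I_m, x \in G & j = x.+1 :> nat.
Proof.
by rewrite inE negbK => /imsetP[x xG ->]; exists x.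
Qed.

Lemma admissible_adj (l : m.+1.-tuple 'I_N) (j k : 'I_m.+1) (x : 'I_m) :
  admissible (m := m.+1) G l -> x \in G -> j = x :> nat -> k = x.+1 :> nat ->
  tnth l k = (tnth l j).+1 :> nat.
Proof.
move=> /andP[_ /forallP/(_ x)/forallP/(_ j)/forallP/(_ k)] + xG jx kx.
by rewrite xG jx kx !eqxx => /eqP.
Qed.

(** Prescribing one entry fixes its whole block; one value remains to be chosen for each other
    block, which saves a factor [N]. *)
Lemma card_admissible_through (k : 'I_m.+1) (i : 'I_N) :
  \sum_(l : m.+1.-tuple 'I_N | admissible (m := m.+1) G l && (tnth l k == i)) 1
  <= N ^ (m - #|G|).
Proof.
have G_le : #|G| <= m by rewrite -[X in _ <= X]card_ord max_card.
have s0_in : ord0 \in block_starts.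
  by rewrite inE; apply/imsetP => -[x _ /(congr1 val)].
pose le_k := [pred j : 'I_m.+1 | (j \in block_starts) && (j <= k)].
have le_k0 : le_k ord0 by rewrite /= s0_in.
(* [s] is the start of the block containing [k]. *)
case: (arg_maxnP val le_k0) => s /= /andP[s_in s_le] s_max.
pose B := block_starts :\ s.
have cardB : #|B| = m - #|G|.
  have := cardsD1 s block_starts.
  by rewrite s_in card_block_starts add1n (subSn G_le) => -[->].
(* The list is encoded by its values at the other starts. The default [i] elsewhere puts the code
   among the functions that [card_pffun_on] counts. *)
pose h (l : m.+1.-tuple 'I_N) : {ffun 'I_m.+1 -> 'I_N} :=
  [ffun j => if j \in B then tnth l j else i].
rewrite sum1_card -cardB -[X in X ^ _]card_ord -(card_pffun_on i).
rewrite -(card_in_image (f := h)).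
  apply: subset_leq_card; apply/subsetP => _ /imageP[l _ ->].
  apply/pffun_onP; split; last by move=> y _.
  by apply/subsetP => j; rewrite unfold_in ffunE; case: ifP => //; rewrite eqxx.
move=> l l'; rewrite !unfold_in => /andP[al /eqP lk] /andP[al' /eqP l'k] /ffunP e.
have adjE (x : 'I_m) (xG : x \in G) (j j' : 'I_m.+1) :
    j = x :> nat -> j' = x.+1 :> nat ->
    (tnth l j' == tnth l' j') = (tnth l j == tnth l' j).
  move=> jx j'x; rewrite -!(inj_eq val_inj) /= (admissible_adj al xG jx j'x).
  by rewrite (admissible_adj al' xG jx j'x) eqSS.
(* Inside the block, agreement at [k] propagates backwards to the start [s]. *)
have back d (j : 'I_m.+1) : j + d = k -> s <= j -> tnth l j == tnth l' j.
  elim: d j => [|d IHd] j jd sj.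
    by have -> : j = k; [apply: val_inj; rewrite /= -jd addn0 | rewrite lk l'k].
  have jm : j.+1 < m.+1 by have := ltn_ord k; lia.
  have jn : Ordinal jm \notin block_starts.
    apply/negP => jin; have := s_max (Ordinal jm); rewrite jin /=.
    by move=> /(_ ltac:(lia)); lia.
  have [x xG /= jx] := notin_block_starts jn.
  rewrite -(adjE x xG j (Ordinal jm)) //; last by lia.
  by apply: IHd => /=; lia.
have agree_s : tnth l s == tnth l' s by apply: (back (k - s)); lia.
have agree_starts j : j \in block_starts -> tnth l j == tnth l' j.
  move=> jin; case: (eqVneq j s) => [-> //|js].
  by have := e j; rewrite !ffunE in_setD1 js jin /= => ->.
have agree n (hn : n < m.+1) : tnth l (Ordinal hn) == tnth l' (Ordinal hn).
  elim: n hn => [|n IHn] hn.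
    by apply: agree_starts; rewrite (_ : Ordinal hn = ord0) //; apply: val_inj.
  have [/agree_starts //|/notin_block_starts[x xG /= nx]] :=
    boolP (Ordinal hn \in block_starts).
  have hn' : n < m.+1 by lia.
  by rewrite (adjE x xG (Ordinal hn')) //=; lia.
apply: eq_from_tnth => j; apply/eqP.
by have := agree j (ltn_ord j); rewrite (_ : Ordinal _ = j) //; apply: val_inj.
Qed.

(** Union bound over the two coordinates at which the lists meet. *)
Lemma card_admissible_meeting (l : m.+1.-tuple 'I_N) :
  \sum_(l' : m.+1.-tuple 'I_N |
        admissible (m := m.+1) G l' && [exists j, exists k, tnth l j == tnth l' k]) 1
  <= m.+1 ^ 2 * N ^ (m - #|G|).
Proof.
apply: leq_trans
  (_ : _ <= \sum_(j < m.+1) \sum_(k < m.+1) N ^ (m - #|G|)) _; last first.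
  by rewrite sum_nat_const sum_nat_const !card_ord mulnA.
apply: leq_trans (leq_sum _ _); last first.
  by move=> j _; apply: leq_sum => k _; exact: (card_admissible_through k (tnth l j)).
rewrite pair_big /=.
rewrite (exchange_big_dep (fun l' => admissible (m := m.+1) G l')) /=; last first.
  by move=> ? ? _ /andP[].
rewrite [X in X <= _]big_mkcond [X in _ <= X]big_mkcond /=; apply: leq_sum => l' _.
case: ifP => // /andP[-> /existsP[j /existsP[k jk]]] /=.
by rewrite (bigD1 (j, k)) //= eq_sym.
Qed.

End Degree.

(** * Sums with a dependency graph: moments and Stein's identity *)

Section FiniteExpectation.
Variables (R : realFieldType) (Omega : finType) (w : Omega -> R).
Hypotheses (w_ge0 : forall o, 0 <= w o) (w_sum : \sum_o w o = 1).

(** Expectation under a law on a finite set given by its weights; it serves for the uniform and for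
    the Ewens law. *)
Definition esp (F : Omega -> R) : R := \sum_o w o * F o.

Lemma eq_esp F G : F =1 G -> esp F = esp G.
Proof. by move=> FG; apply: eq_bigr => o _; rewrite FG. Qed.

Lemma esp_sum (I : finType) (P : pred I) (F : I -> Omega -> R) :
  esp (fun o => \sum_(i | P i) F i o) = \sum_(i | P i) esp (F i).
Proof.
by rewrite /esp exchange_big; apply: eq_bigr => o _; rewrite big_distrr.
Qed.

Lemma espB F G : esp (fun o => F o - G o) = esp F - esp G.
Proof.
by rewrite /esp -sumrB; apply: eq_bigr => o _; rewrite mulrBr.
Qed.

Lemma espD F G : esp (fun o => F o + G o) = esp F + esp G.
Proof.
by rewrite /esp -big_split; apply: eq_bigr => o _; rewrite mulrDr.
Qed.

Lemma espZ c F : esp (fun o => c * F o) = c * esp F.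
Proof. by rewrite /esp big_distrr; apply: eq_bigr => o _; rewrite mulrCA. Qed.

Lemma esp_cst c : esp (fun=> c) = c.
Proof. by rewrite /esp -big_distrl /= w_sum mul1r. Qed.

Lemma le_esp F G : (forall o, F o <= G o) -> esp F <= esp G.
Proof. by move=> FG; apply: ler_sum => o _; rewrite ler_wpM2l. Qed.

Lemma ler_norm_esp F G : (forall o, `|F o| <= G o) -> `|esp F| <= esp G.
Proof.
move=> FG; apply: le_trans (ler_norm_sum _ _ _) _; apply: ler_sum => o _.
by rewrite normrM ger0_norm // ler_wpM2l.
Qed.

Lemma ler_norm_esp_cst F c : (forall o, `|F o| <= c) -> `|esp F| <= c.
Proof. by move=> /ler_norm_esp; rewrite esp_cst. Qed.

End FiniteExpectation.

Section DependencyGraph.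
Variables (R : realFieldType) (Omega I : finType) (w : Omega -> R).
Hypotheses (w_ge0 : forall o, 0 <= w o) (w_sum : \sum_o w o = 1).
Variables (Y : I -> Omega -> R) (nb : rel I) (D : R).
Hypothesis Y_le1 : forall a o, `|Y a o| <= 1.
Hypothesis deg_le : forall a, \sum_(b | nb a b) 1 <= D.
Hypothesis indep1 : forall a (phi : R -> R),
  esp w (fun o => Y a o * phi (\sum_(b | ~~ nb a b) Y b o)) = 0.
Hypothesis indep2 : forall a b (phi : R -> R),
  let T o := phi (\sum_(c | ~~ nb a c && ~~ nb b c) Y c o) in
  esp w (fun o => Y a o * Y b o * T o) =
  esp w (fun o => Y a o * Y b o) * esp w T.
Hypothesis uncorr : forall a b, ~~ nb a b -> esp w (fun o => Y a o * Y b o) = 0.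

Let S o := \sum_a Y a o.
Let Sfar a o := \sum_(b | ~~ nb a b) Y b o.
Let Sfar2 a b o := \sum_(c | ~~ nb a c && ~~ nb b c) Y c o.

Let S_split a o : S o = \sum_(b | nb a b) Y b o + Sfar a o.
Proof. exact: bigID. Qed.

Let near_le a o : `|S o - Sfar a o| <= D.
Proof.
rewrite (S_split a) addrK; apply: le_trans (ler_norm_sum _ _ _) _.
by apply: le_trans (deg_le a); apply: ler_sum.
Qed.

Let near2_le a b o : `|S o - Sfar2 a b o| <= 2 * D.
Proof.
rewrite /S /Sfar2 (bigID (fun c => ~~ nb a c && ~~ nb b c)) /= [X in X - _]addrC addrK.
apply: le_trans (ler_norm_sum _ _ _) _.
apply: le_trans (_ : \sum_c ((nb a c)%:R + (nb b c)%:R) <= _).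
  rewrite big_mkcond; apply: ler_sum => c _; have := Y_le1 c o.
  by case: (nb a c); case: (nb b c) => //= h; rewrite ?addr0 ?add0r //; lra.
rewrite big_split /= (_ : 2 * D = D + D); last by ring.
by apply: lerD; [apply: le_trans (deg_le a) | apply: le_trans (deg_le b)];
  rewrite [leRHS]big_mkcond; apply: ler_sum => c _; case: (nb _ c).
Qed.

Let S2E : esp w (fun o => S o ^+ 2) =
  \sum_a \sum_(b | nb a b) esp w (fun o => Y a o * Y b o).
Proof.
transitivity (\sum_a \sum_b esp w (fun o => Y a o * Y b o)).
  under [RHS]eq_bigr => a _ do rewrite -esp_sum.
  rewrite -esp_sum; apply: eq_esp => o; rewrite expr2 {1}/S big_distrl /=.
  by apply: eq_bigr => a _; rewrite big_distrr.
apply: eq_bigr => a _; rewrite (bigID (nb a)) /= [X in _ + X]big1 ?addr0 //.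
by move=> b /uncorr.
Qed.

(** Only neighbouring pairs are correlated; each variable has at most [D] neighbours, and each
    product is at most 1. *)
Lemma dependency_second_moment : esp w (fun o => S o ^+ 2) <= #|I|%:R * D.
Proof.
rewrite S2E mulr_natl -sumr_const; apply: ler_sum => a _.
apply: le_trans (deg_le a); apply: ler_sum => b _.
apply: le_trans (ler_norm _) _; apply: ler_norm_esp_cst => // o.
by rewrite normrM mulr_ile1.
Qed.

(** Each [Y a] is centered and independent of [Sfar a], so subtracting [phi (Sfar a)] is free and
    leaves the variation of [phi] over a distance at most [D]. *)
Let esp_S_phi (phi : R -> R) :
  esp w (fun o => S o * phi (S o)) =
  \sum_a esp w (fun o => Y a o * (phi (S o) - phi (Sfar a o))).
Proof.
transitivity (\sum_a esp w (fun o => Y a o * phi (S o))).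
  by rewrite -esp_sum; apply: eq_esp => o; rewrite big_distrl.
apply: eq_bigr => a _; rewrite -[LHS]subr0 -(indep1 a phi) -espB.
by apply: eq_esp => o; rewrite mulrBr.
Qed.

(** Stein's identity for the cube: its variation over a step [r] with [|r| <= D] is at most
    [D * (5 * S ^+ 2 + 3 * D ^+ 2)], which reduces the bound to the second moment. *)
Lemma dependency_fourth_moment : 0 <= D ->
  esp w (fun o => S o ^+ 4) <= #|I|%:R * D * (5 * (#|I|%:R * D) + 3 * D ^+ 2).
Proof.
move=> D0.
rewrite (eq_esp w (G := fun o => S o * S o ^+ 3)); last by move=> o; rewrite -exprS.
rewrite (esp_S_phi (fun x => x ^+ 3)).
apply: le_trans
  (_ : \sum_(a : I) D * (5 * esp w (fun o => S o ^+ 2) + 3 * D ^+ 2) <= _).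
  apply: ler_sum => a _; apply: le_trans (ler_norm _) _.
  rewrite -espZ -[X in _ + X](esp_cst w_sum) -espD -espZ.
  apply: ler_norm_esp => // o; rewrite normrM.
  have h := near_le a o; have hY := Y_le1 a o; set r := S o - Sfar a o in h *.
  have -> : Sfar a o = S o - r by rewrite /r; ring.
  have -> : S o ^+ 3 - (S o - r) ^+ 3 = r * (3 * S o ^+ 2 - 3 * (S o * r) + r ^+ 2).
    by ring.
  apply: le_trans (_ : 1 * `|r * (3 * S o ^+ 2 - 3 * (S o * r) + r ^+ 2)| <= _).
    by apply: ler_wpM2r.
  rewrite mul1r normrM; apply: ler_pM => //.
  have r2 : r ^+ 2 <= D ^+ 2 by rewrite -(real_normK (num_real r)) lerXn2r ?nnegrE.
  have hp := sqr_ge0 (S o + r); have hm := sqr_ge0 (S o - r).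
  have hS := sqr_ge0 (S o); have hr := sqr_ge0 r.
  by rewrite ler_norml; apply/andP; split; nra.
rewrite sumr_const -[leLHS]mulr_natl [leLHS]mulrA.
apply: ler_wpM2l; first by rewrite mulr_ge0.
by have := dependency_second_moment; lra.
Qed.

(* [f] plays the role of a test function with derivative [g]; [eps] bounds the
   oscillation of [g] at scale [2 * D / k]. *)
Lemma dependency_stein (f g : R -> R) (k eps : R) : 0 < k -> 0 <= eps ->
    (forall x y, `|x - y| <= 2 * D / k -> `|f x - f y - g x * (x - y)| <= `|x - y| * eps) ->
    (forall x y, `|x - y| <= 2 * D / k -> `|g x - g y| <= eps) ->
  `|esp w (fun o => S o / k * f (S o / k)) -
    esp w (fun o => S o ^+ 2) / k ^+ 2 * esp w (fun o => g (S o / k))| <=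
  3 * (#|I|%:R * D) / k ^+ 2 * eps.
Proof.
move=> k0 eps0 hf hg.
have kV : 0 < k^-1 by rewrite invr_gt0.
suff main : `|esp w (fun o => S o * f (S o / k)) -
    \sum_a \sum_(b | nb a b) esp w (fun o => Y a o * Y b o) / k *
      esp w (fun o => g (S o / k))| <= 3 * (#|I|%:R * D) / k * eps.
  rewrite S2E.
  have -> : esp w (fun o => S o / k * f (S o / k)) =
      k^-1 * esp w (fun o => S o * f (S o / k)).
    by rewrite -espZ; apply: eq_esp => o; ring.
  rewrite expr2 invfM mulrA.
  move: main; under eq_bigr => a _ do rewrite -!big_distrl /=.
  rewrite -!big_distrl /= => main.
  rewrite [X in _ - X](_ : _ = k^-1 * ((\sum_a \sum_(b | nb a b)
    esp w (fun o => Y a o * Y b o)) / k * esp w (fun o => g (S o / k)))); last by ring.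
  rewrite -mulrBr normrM gtr0_norm //.
  rewrite [leRHS](_ : _ = k^-1 * (3 * (#|I|%:R * D) / k * eps)); last by ring.
  by rewrite ler_wpM2l // ltW.
rewrite (esp_S_phi (fun x => f (x / k))) -sumrB.
apply: le_trans (ler_norm_sum _ _ _) _.
rewrite (_ : 3 * _ / k * eps = #|I|%:R * (3 * D / k * eps)); last by ring.
rewrite mulr_natl -sumr_const; apply: ler_sum => a _.
have Da : 0 <= D by apply: le_trans (deg_le a); apply: sumr_ge0.
(* [mid] is the first-order expansion of [f] at [S / k]. Reaching it costs [D / k * eps]; decoupling
   [g (S / k)] from the products [Y a * Y b] then costs [2 * eps / k] for each neighbour. Together
   this gives the factor 3. *)
pose mid := \sum_(b | nb a b) esp w (fun o => Y a o * Y b o * g (S o / k)) / k.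
have midE : mid = esp w (fun o => Y a o * (g (S o / k) * (S o / k - Sfar a o / k))).
  rewrite /mid -big_distrl /= -esp_sum mulrC -espZ; apply: eq_esp => o.
  rewrite -mulrBl (S_split a) addrK.
  under eq_bigr => b _ do rewrite mulrAC.
  by rewrite -big_distrr /=; ring.
rewrite -(subrKA mid); apply: le_trans (ler_normD _ _) _.
rewrite (_ : 3 * D / k * eps = D / k * eps + D * (2 * eps) / k); last by ring.
have dk o : `|S o / k - Sfar a o / k| <= D / k.
  by rewrite -mulrBl normrM (gtr0_norm kV) ler_wpM2r // ltW.
apply: lerD.
  rewrite midE -espB; apply: ler_norm_esp_cst => // o.
  rewrite -mulrBr normrM -[leRHS]mul1r; apply: ler_pM => //.
  apply: le_trans (hf _ _ _) _; last by rewrite ler_wpM2r.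
  by apply: le_trans (dk o) _; apply: ler_wpM2r; [exact: ltW | lra].
rewrite /mid -sumrB; apply: le_trans (ler_norm_sum _ _ _) _.
apply: le_trans (_ : \sum_(b | nb a b) 1 * (2 * eps / k) <= _); last first.
  rewrite -big_distrl /= -[leRHS]mulrA; apply: ler_wpM2r; last exact: deg_le.
  by rewrite mulr_ge0 ?mulr_ge0 // ltW.
apply: ler_sum => b _; rewrite mul1r mulrAC -mulrBl normrM (gtr0_norm kV).
apply: ler_wpM2r; first exact: ltW.
have := indep2 a b (fun x => g (x / k)); rewrite /= -/(Sfar2 a b _) => ind.
(* At [Sfar2] the factor [g] decouples exactly. The error [T] is paid once in the joint expectation
   and once in the product of expectations. *)
pose T o := g (S o / k) - g (Sfar2 a b o / k).
have hT o : `|T o| <= eps.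
  by apply: hg; rewrite -mulrBl normrM (gtr0_norm kV) ler_wpM2r // ltW.
have -> : esp w (fun o => Y a o * Y b o * g (S o / k)) -
    esp w (fun o => Y a o * Y b o) * esp w (fun o => g (S o / k)) =
    esp w (fun o => Y a o * Y b o * T o) - esp w (fun o => Y a o * Y b o) * esp w T.
  rewrite (espB _ (fun o => g (S o / k))).
  rewrite (eq_esp w (F := fun o => Y a o * Y b o * T o) (G := fun o =>
    Y a o * Y b o * g (S o / k) - Y a o * Y b o * g (Sfar2 a b o / k))); last first.
    by move=> o; rewrite /T mulrBr.
  by rewrite espB ind; ring.
have hYY o : `|Y a o * Y b o| <= 1 by rewrite normrM mulr_ile1.
apply: le_trans (ler_normB _ _) _.
rewrite (_ : 2 * eps = eps + eps); last by ring.
apply: lerD.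
  apply: ler_norm_esp_cst => // o; rewrite normrM -[eps]mul1r.
  exact: ler_pM.
rewrite normrM -[eps]mul1r; apply: ler_pM => //; exact: ler_norm_esp_cst.
Qed.

End DependencyGraph.

(** * Centered pattern indicators under the uniform law *)

Lemma card_perm_ord N : #|{perm 'I_N}| = N`!.
Proof. exact: card_Sn. Qed.

Section CenteredMatch.
Variables (R : realFieldType) (p : nat) (tau : 'S_p).

Definition same_order N (s : 'S_N) (l : 'I_p -> 'I_N) : bool :=
  [forall j : 'I_p, forall k : 'I_p, (s (l j) < s (l k))%N == (tau j < tau k)%N].

(** Centered for the uniform law, under which each order of [p] values has probability [1 / p!].
    Positions are given by a plain function, so that [id] and the coordinates of a tuple are both
    allowed. *)
Definition cmatch N (s : 'S_N) (l : 'I_p -> 'I_N) : R :=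
  (same_order s l)%:R - p`!%:R^-1.

Lemma ler_norm_cmatch N (s : 'S_N) l : `|cmatch s l| <= 1.
Proof.
have p1 : 1 <= p`!%:R :> R by rewrite ler1n fact_gt0.
have i0 : 0 <= (p`!%:R^-1 : R) by rewrite invr_ge0 ler0n.
have i1 : p`!%:R^-1 <= 1 :> R by rewrite invf_le1 // (lt_le_trans ltr01).
by rewrite /cmatch ler_norml; case: same_order => /=; apply/andP; split; lra.
Qed.

Lemma cmatch_pat m N (J : 'I_m -> 'I_N) (J_inj : injective J) (s : 'S_N) l A :
  l =1 J \o A -> cmatch s l = cmatch (pat J_inj s) A.
Proof.
move=> lA; congr ((nat_of_bool _)%:R - _); apply: eq_forallb => j; apply: eq_forallb => k.
by rewrite std_lt /= !lA.
Qed.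

Lemma cmatch_ext m N (J : 'I_m -> 'I_N) (J_inj : injective J) rho (s : 'S_N) l :
  (forall i j, J i != l j) -> cmatch (ext J_inj rho * s)%g l = cmatch s l.
Proof.
move=> h; congr ((nat_of_bool _)%:R - _); apply: eq_forallb => j; apply: eq_forallb => k.
by rewrite !permM !ext_out.
Qed.

(** Lets a permutation be recovered from its relative order, so that [tau] is the only permutation
    with the order of [tau]. *)
Lemma card_perm_lt n (t : 'S_n) j : #|[pred k | (t k < t j)%N]| = t j.
Proof.
rewrite -[RHS]card_ord -(card_image (@perm_inj _ t)).
rewrite -(card_image (f := widen_ord (ltnW (ltn_ord (t j))))); last first.
  by move=> x y /(congr1 val) /= /val_inj.
apply: eq_card => i; apply/imageP/imageP => [[k + ->]|[k _ ->]].
  by rewrite inE => lt; exists (Ordinal lt) => //; apply: val_inj.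
exists (t^-1%g (widen_ord (ltnW (ltn_ord (t j))) k)); rewrite ?permKV //.
by rewrite inE permKV /=.
Qed.

Lemma same_order_id (t : 'S_p) : same_order t id = (t == tau).
Proof.
apply/idP/eqP => [/forallP h|->]; last by do 2!apply/forallP => ?.
apply/permP => j; apply: val_inj; rewrite /= -[LHS]card_perm_lt -[RHS]card_perm_lt.
by apply: eq_card => k; rewrite !inE; have /forallP/(_ j)/eqP := h k.
Qed.


Lemma sum_cmatch0 : \sum_(t : 'S_p) cmatch t id = 0.
Proof.
have p0 : p`!%:R != 0 :> R by rewrite pnatr_eq0 -lt0n fact_gt0.
rewrite sumrB (bigD1 tau) //= same_order_id eqxx big1 ?addr0; last first.
  by move=> t /negbTE; rewrite same_order_id => ->.
by rewrite sumr_const card_perm_ord -[X in _ - X]mulr_natl divff ?subrr.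
Qed.

Lemma sum_cmatch_mul0 N (l : 'I_p -> 'I_N) (l_inj : injective l) (G : 'S_N -> R) :
    (forall rho s, G (ext l_inj rho * s)%g = G s) ->
  \sum_(s : 'S_N) cmatch s l * G s = 0.
Proof.
move=> hG; under eq_bigr => s _ do rewrite (cmatch_pat l_inj s (A := id)) //.
by rewrite (sum_pat_indep (fun t => cmatch t id)) // sum_cmatch0 !mul0r.
Qed.

End CenteredMatch.

Section UniformPermutation.
Variables (R : realFieldType) (p : nat) (tau : 'S_p) (N : nat).

Definition unif (_ : 'S_N) : R := N`!%:R^-1.

Lemma unif_ge0 s : 0 <= unif s.
Proof. by rewrite invr_ge0 ler0n. Qed.

Lemma fact_neq0 n : n`!%:R != 0 :> R.
Proof. by rewrite pnatr_eq0 -lt0n fact_gt0. Qed.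

Lemma unif_sum : \sum_s unif s = 1.
Proof.
by rewrite sumr_const card_perm_ord -[LHS]mulr_natl divff // fact_neq0.
Qed.

Lemma esp_unif F : esp unif F = N`!%:R^-1 * \sum_s F s.
Proof. by rewrite /esp big_distrr. Qed.

Lemma esp_pat m (J : 'I_m -> 'I_N) (J_inj : injective J) (Phi : 'S_m -> R) G :
    (forall rho s, G (ext J_inj rho * s)%g = G s) ->
  esp unif (fun s => Phi (pat J_inj s) * G s) =
  m`!%:R^-1 * (\sum_t Phi t) * esp unif G.
Proof.
by move=> hG; rewrite !esp_unif sum_pat_indep //; ring.
Qed.

Lemma esp_pat1 m (J : 'I_m -> 'I_N) (J_inj : injective J) (Phi : 'S_m -> R) :
  esp unif (fun s => Phi (pat J_inj s)) = m`!%:R^-1 * \sum_t Phi t.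
Proof.
have := @esp_pat m J J_inj Phi (fun=> 1) (fun _ _ => erefl).
rewrite (esp_cst unif_sum) mulr1 => <-.
by apply: eq_esp => s; rewrite mulr1.
Qed.

Definition meets (a b : p.-tuple 'I_N) : bool := [exists j, exists k, tnth a j == tnth b k].

Let Y (a : p.-tuple 'I_N) (s : 'S_N) : R := cmatch R tau s (tnth a).

Lemma cmatch_far m (J : 'I_m -> 'I_N) (J_inj : injective J) rho (s : 'S_N)
    (b : p.-tuple 'I_N) :
  (forall i k, J i != tnth b k) -> Y b (ext J_inj rho * s)%g = Y b s.
Proof. exact: cmatch_ext. Qed.

(** Relabelling the positions of [a] leaves every far tuple untouched, so the order on [a] stays
    uniform whatever their sum is. The index type is general in order to cover both a large sum and
    a single tuple. *)
Lemma esp_cmatch_far (T : finType) (b : T -> p.-tuple 'I_N) (P : pred T)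
    (a : p.-tuple 'I_N) (phi : R -> R) : injective (tnth a) ->
  (forall i, P i -> ~~ meets a (b i)) ->
  esp unif (fun s => Y a s * phi (\sum_(i | P i) Y (b i) s)) = 0.
Proof.
move=> a_inj far; rewrite esp_unif (@sum_cmatch_mul0 R p tau N _ a_inj) ?mulr0 //.
move=> rho s; congr phi; apply: eq_bigr => i /far h; apply: cmatch_far => j k.
by apply: contra h => /eqP jk; apply/existsP; exists j; apply/existsP; exists k; apply/eqP.
Qed.

Lemma esp_cmatch_uncorr (a b : p.-tuple 'I_N) : injective (tnth a) ->
  ~~ meets a b -> esp unif (fun s => Y a s * Y b s) = 0.
Proof.
move=> a_inj far; rewrite -(@esp_cmatch_far unit (fun=> b) xpredT a id) //.
by apply: eq_esp => s; rewrite big_const card_unit /= addr0.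
Qed.

(** Both [Y a] and [Y b] are functions of the relative order on the union [C] of their positions,
    and relabelling [C] does not affect the tuples disjoint from [a] and [b]. *)
Lemma esp_cmatch2_far (T : finType) (c : T -> p.-tuple 'I_N) (P : pred T)
    (a b : p.-tuple 'I_N) (phi : R -> R) :
  (forall i, P i -> ~~ meets a (c i) && ~~ meets b (c i)) ->
  let F s := phi (\sum_(i | P i) Y (c i) s) in
  esp unif (fun s => Y a s * Y b s * F s) =
  esp unif (fun s => Y a s * Y b s) * esp unif F.
Proof.
move=> far /=.
pose C := [set x | (x \in a) || (x \in b)].
have aC j : tnth a j \in C by rewrite inE mem_tnth.
have bC j : tnth b j \in C by rewrite inE mem_tnth orbT.
pose J (i : 'I_#|C|) := enum_val i.
have J_inj : injective J by exact: enum_val_inj.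
pose A j := enum_rank_in (aC j) (tnth a j); pose B j := enum_rank_in (bC j) (tnth b j).
have aA : tnth a =1 J \o A by move=> j; rewrite /J /A /= enum_rankK_in.
have bB : tnth b =1 J \o B by move=> j; rewrite /J /B /= enum_rankK_in.
pose Phi t := cmatch R tau t A * cmatch R tau t B.
have YY s : Y a s * Y b s = Phi (pat J_inj s).
  by rewrite /Y (cmatch_pat _ _ J_inj s aA) (cmatch_pat _ _ J_inj s bB).
under eq_esp => s do rewrite YY.
under [in RHS]eq_esp => s do rewrite YY.
rewrite esp_pat ?esp_pat1 // => rho s; congr phi; apply: eq_bigr => i /far /andP[ha hb].
apply: cmatch_far => j k; have : J j \in C by exact: enum_valP.
rewrite inE; case/orP => /tnthP[j' ->].
  apply: contra ha => jk; by apply/existsP; exists j'; apply/existsP; exists k.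
apply: contra hb => jk; by apply/existsP; exists j'; apply/existsP; exists k.
Qed.

End UniformPermutation.

(** * Shapes of overlapping pairs of occurrences *)

Section IncreasingTuples.
Local Open Scope nat_scope.

Definition increasing m N (l : m.-tuple 'I_N) : bool :=
  [forall j : 'I_m, forall k : 'I_m, (j < k) ==> (tnth l j < tnth l k)].

Lemma increasingP m N (l : m.-tuple 'I_N) :
  reflect (forall j k : 'I_m, j < k -> tnth l j < tnth l k) (increasing l).
Proof.
apply: (iffP forallP) => [h j k jk|h j].
  by have /forallP/(_ k)/implyP/(_ jk) := h j.
by apply/forallP => k; apply/implyP => /h.
Qed.

Lemma increasing_ltE m N (l : m.-tuple 'I_N) (j k : 'I_m) :
  increasing l -> (tnth l j < tnth l k) = (j < k).
Proof.
move=> /increasingP h; case: (ltngtP j k) => [/h //|/h|/val_inj ->].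
  by move=> kj; apply/negbTE; rewrite -leqNgt ltnW.
by rewrite ltnn.
Qed.

Lemma increasing_inj m N (l : m.-tuple 'I_N) : increasing l -> injective (tnth l).
Proof.
move=> h j k e; apply: val_inj => /=; case: (ltngtP j k) => // jk.
  by have := increasing_ltE j k h; rewrite jk e ltnn.
by have := increasing_ltE k j h; rewrite jk e ltnn.
Qed.

Lemma increasing_sorted m N (l : m.-tuple 'I_N) :
  increasing l = sorted (fun x y : 'I_N => x < y) l.
Proof.
have tr : transitive (fun x y : 'I_N => x < y) by move=> ? ? ?; exact: ltn_trans.
case: m l => [|m] l; first by rewrite tuple0; apply/forallP => -[].
have [x0 _] : exists x0 : 'I_N, true by exists (tnth l ord0).
rewrite sorted_pairwise //; apply/increasingP/(pairwiseP x0) => h.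
  move=> i j; rewrite !inE size_tuple => im jm ij.
  by have := h (Ordinal im) (Ordinal jm) ij; rewrite !(tnth_nth x0).
move=> j k jk; rewrite !(tnth_nth x0).
by apply: h; rewrite ?inE ?size_tuple.
Qed.

(** A finite set has exactly one increasing enumeration. Written as a sum equal to 1, this fact can
    be inserted into another sum and exchanged with it. *)
Lemma sum_increasing_enum N M (C : {set 'I_N}) : 0 < #|C| <= M ->
  \sum_(n < M) \sum_(J : n.+1.-tuple 'I_N | increasing J && ([set x in J] == C)) 1 = 1.
Proof.
move=> /andP[C0 CM].
have pM : #|C|.-1 < M by lia.
have card_J n (J : n.-tuple 'I_N) : increasing J -> #|[set x in J]| = n.
  by move=> /increasing_inj/tuple_uniqP; rewrite cardsE => /card_uniqP ->; rewrite size_tuple.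
rewrite (bigD1 (Ordinal pM)) //= [X in _ + X]big1 ?addn0; last first.
  move=> n; rewrite -(inj_eq val_inj) /= => nC; apply: big_pred0 => J.
  apply/negbTE/negP => /andP[/card_J cJ /eqP JC].
  by move/eqP: nC; apply; rewrite -JC cJ.
have sizeC : size (enum C) == #|C|.-1.+1 by rewrite -cardE prednK.
have tr : transitive (fun x y : 'I_N => x < y) by move=> ? ? ?; exact: ltn_trans.
have sortedC : sorted (fun x y : 'I_N => x < y) (enum C).
  rewrite /enum_mem -enumT; apply: sorted_filter => //.
  have := iota_ltn_sorted 0 N; rewrite -val_enum_ord sorted_map.
  by move=> h; apply: sub_sorted h.
rewrite (big_pred1 (Tuple sizeC)) // => J; rewrite increasing_sorted.
apply/andP/eqP => [[sJ /eqP JC]|->]; last first.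
  by split=> //=; apply/eqP/setP => x; rewrite inE /= mem_enum.
apply: val_inj => /=; apply: (irr_sorted_eq tr) => // [x|x]; first exact: ltnn.
by rewrite mem_enum -[in RHS]JC inE.
Qed.

Definition pos_base m (x : 'I_m) : 'I_m.+1 := widen_ord (leqnSn m) x.
Definition pos_next m (x : 'I_m) : 'I_m.+1 := lift ord0 x.

Lemma admissibleP m N (G : {set 'I_m}) (l : m.+1.-tuple 'I_N) :
  reflect (increasing l /\ forall x, x \in G ->
      tnth l (pos_next x) = (tnth l (pos_base x)).+1 :> nat)
    (admissible (m := m.+1) G l).
Proof.
apply: (iffP andP) => -[inc h]; split => //.
  by move=> x xG; apply: (admissible_adj (G := G)) xG _ _; rewrite // /admissible inc.
apply/forallP => x; apply/forallP => j; apply/forallP => k.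
apply/implyP => /and3P[/h xG /eqP jx /eqP kx].
have -> : k = pos_next x by exact: val_inj.
by have -> : j = pos_base x; [exact: val_inj | apply/eqP].
Qed.

End IncreasingTuples.

Section Shapes.
Local Open Scope nat_scope.
Variables (q : nat) (X : {set 'I_q}).
Let p := q.+1.

(** The adjacencies forced on an enumeration [J] when [J \o A] has to respect [X]. *)
Definition links n (A : p.-tuple 'I_n.+1) : {set 'I_n} :=
  [set y : 'I_n | [exists x in X, tnth A (pos_base x) == y :> nat]].

Definition comp_tuple m n N (J : m.-tuple 'I_N) (A : n.-tuple 'I_m) : n.-tuple 'I_N :=
  [tuple of map (tnth J) A].

Lemma tnth_comp m n N (J : m.-tuple 'I_N) (A : n.-tuple 'I_m) :
  tnth (comp_tuple J A) =1 tnth J \o tnth A.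
Proof. by move=> j; rewrite tnth_map. Qed.

(** An increasing [J] cannot make non-adjacent elements adjacent, so an adjacency required of
    [J \o A] splits into one for [A] and one for [J]. *)
Lemma admissible_comp n N (J : n.+1.-tuple 'I_N) (A B : p.-tuple 'I_n.+1) :
  increasing J ->
  admissible (m := p) X (comp_tuple J A) && admissible (m := p) X (comp_tuple J B) =
  [&& admissible (m := p) X A, admissible (m := p) X B &
      admissible (m := n.+1) (links A :|: links B) J].
Proof.
move=> incJ.
have fwd (A' : p.-tuple 'I_n.+1) : admissible (m := p) X (comp_tuple J A') ->
    admissible (m := p) X A' /\ forall y, y \in links A' ->
      tnth J (pos_next y) = (tnth J (pos_base y)).+1 :> nat.
  move=> /admissibleP[/increasingP inc adj].
  have incA (j k : 'I_p) : j < k -> tnth A' j < tnth A' k.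
    by move=> /inc; rewrite !tnth_comp /= (increasing_ltE _ _ incJ).
  have adjA x : x \in X -> tnth A' (pos_next x) = (tnth A' (pos_base x)).+1 :> nat.
    move=> xX; have lt : tnth A' (pos_base x) < tnth A' (pos_next x).
      by apply: incA; rewrite /= /bump.
    apply/eqP; rewrite eqn_leq lt andbT leqNgt; apply/negP => lt2.
    have mid : (tnth A' (pos_base x)).+1 < n.+1 by have := ltn_ord (tnth A' (pos_next x)); lia.
    have h1 : tnth J (tnth A' (pos_base x)) < tnth J (Ordinal mid).
      by rewrite increasing_ltE.
    have h2 : tnth J (Ordinal mid) < tnth J (tnth A' (pos_next x)).
      by rewrite increasing_ltE.
    by have := leq_ltn_trans h1 h2; have := adj x xX; rewrite !tnth_comp /= => ->; rewrite ltnn.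
  split; first by apply/admissibleP; split => //; apply/increasingP.
  move=> y; rewrite inE => /existsP[x /andP[xX /eqP xy]].
  have <- : tnth A' (pos_next x) = pos_next y.
    by apply: val_inj; rewrite /= adjA // xy.
  have <- : tnth A' (pos_base x) = pos_base y by exact: val_inj.
  by have := adj x xX; rewrite !tnth_comp.
have bwd (A' : p.-tuple 'I_n.+1) : admissible (m := p) X A' ->
    (forall y, y \in links A' -> tnth J (pos_next y) = (tnth J (pos_base y)).+1 :> nat) ->
    admissible (m := p) X (comp_tuple J A').
  move=> /admissibleP[/increasingP inc adj] h; apply/admissibleP; split.
    by apply/increasingP => j k /inc; rewrite !tnth_comp /= (increasing_ltE _ _ incJ).
  move=> x xX; rewrite !tnth_comp /=.
  have yn : tnth A' (pos_base x) < n.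
    by have := ltn_ord (tnth A' (pos_next x)); rewrite adj.
  have eb : tnth A' (pos_base x) = pos_base (Ordinal yn) by apply: val_inj.
  have en : tnth A' (pos_next x) = pos_next (Ordinal yn) by apply: val_inj; rewrite /= adj.
  rewrite en (congr1 (tnth J) eb); apply: h.
  by rewrite inE; apply/existsP; exists x; rewrite xX /=.
apply/andP/and3P => [[/fwd[aA hA] /fwd[aB hB]]|[aA aB /admissibleP[_ h]]].
  by split=> //; apply/admissibleP; split=> // y; rewrite in_setU => /orP[/hA|/hB].
by split; apply: bwd => // y yG; apply: h; rewrite in_setU yG ?orbT.
Qed.

(** By contraposition: a link of [X] before [j] is carried by [A] to a link of [G]. *)
Lemma start_image n (A : p.-tuple 'I_n.+1) (G : {set 'I_n}) j :
  admissible (m := p) X A -> links A \subset G ->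
  tnth A j \in block_starts G -> j \in block_starts X.
Proof.
move=> /admissibleP[_ adj] /subsetP AG; apply: contraLR.
move=> /notin_block_starts[x xX jx]; rewrite inE negbK.
have ej : j = pos_next x by exact: val_inj.
have yn : tnth A (pos_base x) < n.
  by have := ltn_ord (tnth A (pos_next x)); rewrite adj.
apply/imsetP; exists (Ordinal yn).
  by apply: AG; rewrite inE; apply/existsP; exists x; rewrite xX /=.
by apply: val_inj; rewrite /= ej adj.
Qed.

(* At a first common position, either two block starts coincide or the start of
   one block lies inside a block of the other tuple. *)
Lemma blocks_overlap n (A B : p.-tuple 'I_n.+1) :
  admissible (m := p) X A -> admissible (m := p) X B -> meets A B ->
  [set x in A] :|: [set x in B] = [set: 'I_n.+1] ->
  n.+1 - #|links A :|: links B| <= 2 * (p - #|X|) - 1.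
Proof.
move=> aA aB mAB cover; set G := links A :|: links B.
have sA : links A \subset G by exact: subsetUl.
have sB : links B \subset G by exact: subsetUr.
rewrite -card_block_starts -(card_block_starts X).
pose SA := tnth A @: block_starts X; pose SB := tnth B @: block_starts X.
have cSA : #|SA| <= #|block_starts X| by exact: leq_imset_card.
have cSB : #|SB| <= #|block_starts X| by exact: leq_imset_card.
have cU : #|SA :|: SB| <= #|SA| + #|SB| by exact: leq_card_setU.
(* It is enough that the block starts of [G] miss one element of [SA :|: SB]. *)
have ar (d g : nat) : #|SA :|: SB| = true + d -> g <= d -> g <= 2 * #|block_starts X| - 1.
  move: cU cSA cSB; move: #|SA :|: SB| #|SA| #|SB| #|block_starts X|; clear; lia.
have sub : block_starts G \subset SA :|: SB.
  apply/subsetP => y yG; have : y \in [set: 'I_n.+1] by [].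
  rewrite -cover !inE; case/orP => /tnthP[j ej]; apply/orP; [left|right];
    apply/imsetP; exists j => //; rewrite ej in yG.
    exact: start_image yG.
  exact: start_image yG.
(* The common position of smallest index [j] in [A]. *)
have [j [k [jk hmin]]] : exists j k, tnth A j = tnth B k /\
    forall j' k', tnth A j' = tnth B k' -> j <= j'.
  have /existsP[j0 j0P] : [exists j, exists k, tnth A j == tnth B k] := mAB.
  case: (arg_minnP (P := fun j => [exists k, tnth A j == tnth B k]) val j0P).
  move=> j /existsP[k /eqP jk] hmin; exists j, k; split=> // j' k' e.
  by apply: hmin; apply/existsP; exists k'; rewrite e.
have [jX|jX] := boolP (j \in block_starts X); last first.
  have [kX|kX] := boolP (k \in block_starts X).
    have nG : tnth B k \notin block_starts G.
      by rewrite -jk; apply: contra jX; exact: start_image.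
    have kin : tnth B k \in SA :|: SB by rewrite !inE; apply/orP; right; apply/imsetP; exists k.
    have : block_starts G \subset (SA :|: SB) :\ tnth B k.
      by apply/subsetD1P.
    move=> /subset_leq_card; have := cardsD1 (tnth B k) (SA :|: SB).
    by rewrite kin => h1 h2; exact: ar h1 h2.
  (* Neither index starts a block, so the preceding positions coincide as well, against the
     minimality of [j]. *)
  have [x xX jx] := notin_block_starts jX; have [x' x'X kx'] := notin_block_starts kX.
  have /admissibleP[_ adjA] := aA; have /admissibleP[_ adjB] := aB.
  have ej : j = pos_next x by exact: val_inj.
  have ek : k = pos_next x' by exact: val_inj.
  suff /hmin : tnth A (pos_base x) = tnth B (pos_base x') by rewrite jx /= ltnn.
  by apply: val_inj; apply: succn_inj; rewrite -adjA // -adjB // -ej -ek jk.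
have Aj : tnth A j \in SA by apply/imsetP; exists j.
have [kX|kX] := boolP (k \in block_starts X).
  have Bk : tnth A j \in SB by rewrite jk; apply/imsetP; exists k.
  have := cardsUI SA SB.
  have : 0 < #|SA :&: SB| by apply/card_gt0P; exists (tnth A j); rewrite inE Aj.
  move: (subset_leq_card sub) cSA cSB; clear.
  move: #|SA :|: SB| #|SA :&: SB| #|SA| #|SB| #|block_starts X| #|block_starts G|; lia.
have nG : tnth A j \notin block_starts G.
  by rewrite jk; apply: contra kX; exact: start_image.
have jin : tnth A j \in SA :|: SB by rewrite inE Aj.
have : block_starts G \subset (SA :|: SB) :\ tnth A j by apply/subsetD1P.
move=> /subset_leq_card; have := cardsD1 (tnth A j) (SA :|: SB).
by rewrite jin => h1 h2; exact: ar h1 h2.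
Qed.

End Shapes.

Section SumOverShapes.
Variables (R : realFieldType) (q : nat) (X : {set 'I_q}) (tau : 'S_q.+1).
Let p := q.+1.

Definition pair_esp N (a b : p.-tuple 'I_N) : R :=
  esp (unif R (N := N)) (fun s => cmatch R tau s (tnth a) * cmatch R tau s (tnth b)).

Lemma pair_esp_comp n N (J : n.-tuple 'I_N) (A B : p.-tuple 'I_n) : increasing J ->
  pair_esp (comp_tuple J A) (comp_tuple J B) = pair_esp A B.
Proof.
move=> /increasing_inj J_inj.
pose Phi t := cmatch R tau t (tnth A) * cmatch R tau t (tnth B).
rewrite /pair_esp [RHS]esp_unif -(esp_pat1 J_inj Phi).
apply: eq_esp => s.
by rewrite !(cmatch_pat _ _ J_inj s (tnth_comp J _)).
Qed.

(** A shape is a meeting pair up to increasing relabelling, made canonical by asking its positions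
    to cover ['I_n.+1]. *)
Definition shape_ok n (AB : p.-tuple 'I_n.+1 * p.-tuple 'I_n.+1) : bool :=
  [&& admissible (m := p) X AB.1, admissible (m := p) X AB.2, meets AB.1 AB.2 &
      [set x in AB.1] :|: [set x in AB.2] == [set: 'I_n.+1]].

(** Composition with [J] is undone by [g], which inverts [J] on its image and takes the junk value
    [ord0] elsewhere. *)
Lemma reindex_shape N n (J : n.+1.-tuple 'I_N) (F : p.-tuple 'I_N * p.-tuple 'I_N -> R)
    (P : pred (p.-tuple 'I_N * p.-tuple 'I_N)) : increasing J ->
  \sum_(ab | P ab && ([set x in J] == [set x in ab.1] :|: [set x in ab.2])) F ab =
  \sum_(AB : p.-tuple 'I_n.+1 * p.-tuple 'I_n.+1 |
      P (comp_tuple J AB.1, comp_tuple J AB.2) &&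
      ([set x in AB.1] :|: [set x in AB.2] == [set: 'I_n.+1]))
    F (comp_tuple J AB.1, comp_tuple J AB.2).
Proof.
move=> incJ; have J_inj := increasing_inj incJ.
pose g (x : 'I_N) : 'I_n.+1 := odflt ord0 [pick i | tnth J i == x].
have gJ i : g (tnth J i) = i.
  by rewrite /g; case: pickP => [i' /eqP/J_inj -> //|/(_ i)]; rewrite eqxx.
have Jg x : x \in J -> tnth J (g x) = x by move=> /tnthP[i ->]; rewrite gJ.
pose h (AB : p.-tuple 'I_n.+1 * p.-tuple 'I_n.+1) :=
  (comp_tuple J AB.1, comp_tuple J AB.2).
pose h' (ab : p.-tuple 'I_N * p.-tuple 'I_N) :=
  ([tuple of map g ab.1], [tuple of map g ab.2]).
have h'h AB : h' (h AB) = AB.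
  case: AB => A B; congr (_, _); apply: eq_from_tnth => j;
  by rewrite !tnth_map gJ.
have imcomp (A : p.-tuple 'I_n.+1) : [set x in comp_tuple J A] = tnth J @: [set x in A].
  apply/setP => x; rewrite inE; apply/mapP/imsetP => -[i iA ->]; exists i => //.
    by rewrite inE.
  by rewrite inE in iA.
have imJ : [set x in J] = tnth J @: [set: 'I_n.+1].
  apply/setP => x; rewrite inE; apply/tnthP/imsetP => [[i ->]|[i _ ->]]; last by exists i.
  by exists i.
rewrite (reindex_onto h h') /=; last first.
  move=> [a b] /= /andP[_ /eqP e].
  have sub x : (x \in a) || (x \in b) -> x \in J.
    by move=> xab; have : x \in [set x in J]; [rewrite e !inE | rewrite inE].
  congr (_, _); apply: eq_from_tnth => j; rewrite !tnth_map Jg //;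
  by apply: sub; rewrite mem_tnth ?orbT.
apply: eq_bigl => AB; rewrite h'h eqxx andbT; congr (_ && _).
rewrite !imcomp imJ -imsetU eq_sym; apply/eqP/eqP => [/imset_inj|-> //].
by apply.
Qed.

(** Each pair is attached to the increasing enumeration [J] of the union of its positions, which has
    between 1 and [2 * p] elements. For a fixed shape, [J] ranges over the lists admissible for the
    links of the shape. *)
Lemma sum_pairs_shapes N :
  \sum_(ab : p.-tuple 'I_N * p.-tuple 'I_N |
      [&& admissible (m := p) X ab.1, admissible (m := p) X ab.2 & meets ab.1 ab.2])
    pair_esp ab.1 ab.2 =
  \sum_(n < 2 * p) \sum_(AB : p.-tuple 'I_n.+1 * p.-tuple 'I_n.+1 | shape_ok AB)
    pair_esp AB.1 AB.2 *
      'C(N - #|links X AB.1 :|: links X AB.2|, n.+1 - #|links X AB.1 :|: links X AB.2|)%:R.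
Proof.
pose P (ab : p.-tuple 'I_N * p.-tuple 'I_N) :=
  [&& admissible (m := p) X ab.1, admissible (m := p) X ab.2 & meets ab.1 ab.2].
pose C (ab : p.-tuple 'I_N * p.-tuple 'I_N) := [set x in ab.1] :|: [set x in ab.2].
transitivity (\sum_(ab | P ab) \sum_(n < 2 * p) \sum_(J : n.+1.-tuple 'I_N |
    increasing J && ([set x in J] == C ab)) pair_esp ab.1 ab.2).
  apply: eq_bigr => ab _.
  have := @sum_increasing_enum N (2 * p) (C ab).
  have -> : (0 < #|C ab| <= 2 * p)%N.
    apply/andP; split.
      by apply/card_gt0P; exists (tnth ab.1 ord0); rewrite !inE mem_tnth.
    apply: leq_trans (leq_card_setU _ _) _; rewrite mul2n -addnn.
    by apply: leq_add; rewrite cardsE (leq_trans (card_size _)) // size_tuple.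
  move=> /(_ isT)/(congr1 (fun n => n%:R : R)) /= one.
  rewrite -[LHS]mul1r -[X in X * _ = _]one natr_sum big_distrl /=.
  by apply: eq_bigr => n _; rewrite natr_sum big_distrl; apply: eq_bigr => J _; rewrite /= mul1r.
rewrite exchange_big; apply: eq_bigr => n _ /=.
transitivity (\sum_(J : n.+1.-tuple 'I_N | increasing J)
    \sum_(ab | P ab && ([set x in J] == C ab)) pair_esp ab.1 ab.2).
  rewrite (exchange_big_dep (fun J => increasing J)) /=; last by move=> ? ? _ /andP[].
  apply: eq_bigr => J incJ; apply: eq_bigl => ab; by rewrite incJ.
transitivity (\sum_(J : n.+1.-tuple 'I_N | increasing J) \sum_(AB | shape_ok AB &&
    admissible (m := n.+1) (links X AB.1 :|: links X AB.2) J) pair_esp AB.1 AB.2).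
  apply: eq_bigr => J incJ; rewrite reindex_shape //=; apply: eq_big => [AB|AB _].
    have mE : meets (comp_tuple J AB.1) (comp_tuple J AB.2) = meets AB.1 AB.2.
      apply: eq_existsb => j; apply: eq_existsb => k; rewrite !tnth_comp /=.
      exact: inj_eq (increasing_inj incJ) _ _.
    rewrite /P /shape_ok /= mE andbA (admissible_comp X AB.1 AB.2 incJ).
    case: (admissible (m := p) X AB.1); case: (admissible (m := p) X AB.2) => //=.
    by rewrite -andbA andbC.
  exact: pair_esp_comp.
rewrite (exchange_big_dep (@shape_ok n)) /=; last by move=> ? ? _ /andP[].
apply: eq_bigr => AB okAB.
rewrite -(@card_admissible n.+1 N) // natr_sum big_distrr /=.
apply: eq_big => [J|J _]; last by rewrite mulr1.
by rewrite okAB /=; apply: andb_idl => /admissibleP[].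
Qed.

End SumOverShapes.

(** * Comparison of the Ewens and uniform laws *)

Section EwensUniform.
Variables (R : realFieldType) (theta : R) (N : nat).
Hypothesis theta_gt0 : 0 < theta.

(** The permutations of the first [k] points, kept inside ['S_N] so that all steps of the
    construction live in one group. *)
Definition fixes_from k (s : 'S_N) : bool := [forall x : 'I_N, (k <= x)%N ==> (s x == x)].

Lemma fixes_fromP k (s : 'S_N) :
  reflect (forall x : 'I_N, (k <= x)%N -> s x = x) (fixes_from k s).
Proof.
by apply: (iffP forallP) => h x; [move/(implyP (h x))/eqP | apply/implyP => /h ->].
Qed.

(** The index [i] is the point sent to [k]; removing the transposition turns [k] into a fixed
    point. *)
Lemma sum_fixes_fromS (k : 'I_N) (F : 'S_N -> R) :
  \sum_(s | fixes_from k.+1 s) F s =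
  \sum_(s | fixes_from k s) \sum_(i : 'I_N | (i <= k)%N) F (tperm k i * s)%g.
Proof.
rewrite (partition_big (fun s : 'S_N => s^-1%g k) (fun i => (i <= k)%N)) /=; last first.
  move=> s /fixes_fromP h; rewrite leqNgt; apply/negP => lt.
  by have := h _ lt; rewrite permKV => e; rewrite -e ltnn in lt.
rewrite [RHS]exchange_big; apply: eq_bigr => i ik.
rewrite (reindex_inj (mulgI (tperm k i))) /=; apply: eq_bigl => s.
have tfix (x : 'I_N) : (k < x)%N -> tperm k i x = x.
  move=> kx; rewrite tpermD //; apply/eqP => e; move: kx; rewrite -e ?ltnn //.
  by rewrite ltnNge ik.
apply/andP/fixes_fromP => [[/fixes_fromP h /eqP e] x|h].
  rewrite leq_eqVlt => /orP[/eqP/val_inj <-|kx]; last first.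
    by have := h x kx; rewrite permM tfix.
  by have := permKV (tperm k i * s)%g k; rewrite e permM tpermR.
split; first by apply/fixes_fromP => x kx; rewrite permM tfix // h // ltnW.
by apply/eqP/(@perm_inj _ (tperm k i * s)%g); rewrite permKV permM tpermR h.
Qed.

Lemma porbit_fixed (s : 'S_N) (k : 'I_N) : s k = k -> porbit s k = [set k].
Proof.
move=> sk; apply/setP => x; rewrite inE; apply/porbitP/eqP => [[n ->]|->].
  by elim: n => [|n IHn]; rewrite ?expg0 ?perm1 // expgSr permM IHn.
by exists 0; rewrite expg0 perm1.
Qed.

(** The transposition merges the fixed point [k] into the cycle of [i]. Among the choices of [i],
    only [i = k] keeps this cycle and its factor [theta]. *)
Lemma porbits_tperm_fixed (s : 'S_N) (k i : 'I_N) : s k = k -> i != k ->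
  #|porbits s| = #|porbits (tperm k i * s)|.+1.
Proof.
move=> sk ik; have := porbits_mul_tperm s i k; rewrite /= tpermC ik.
by rewrite porbit_fixed // inE ik /= addn1 addn2 => -[->].
Qed.

Lemma card_porbits1 : #|porbits (1 : 'S_N)%g| = N.
Proof.
rewrite /porbits card_imset ?card_ord // => x y.
by rewrite !porbit_fixed ?perm1 // => /set1_inj.
Qed.

(** The bound 3 comes from two choices [i] and [j] at the same step [k]: the results differ at most
    at [k], [i] and [j]. *)
Definition close_perms (s t : 'S_N) : bool := (#|[pred x | s x != t x]| <= 3)%N.

Lemma close_perms_mull (u s t : 'S_N) : close_perms (u * s)%g (u * t)%g = close_perms s t.
Proof.
rewrite /close_perms; congr (_ <= 3)%N.
rewrite -(card_image (@perm_inj _ u)); apply: eq_card => x.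
by rewrite -[x](permKV u) mem_image ?inE ?permM //; exact: perm_inj.
Qed.

Lemma close_perms_tperm (k i j : 'I_N) (s : 'S_N) :
  close_perms (tperm k i * s)%g (tperm k j * s)%g.
Proof.
rewrite /close_perms; apply: leq_trans (_ : #|[:: k; i; j]| <= 3)%N; last first.
  exact: card_size.
apply/subset_leq_card/subsetP => x; rewrite !inE !permM; apply: contraR.
rewrite !negb_or => /and3P[xk xi xj].
by rewrite !tpermD // eq_sym.
Qed.

Let ewens_mass k (H : 'S_N -> R) := \sum_(s | fixes_from k s) theta ^+ #|porbits s| * H s.

Let drift (delta : R) k := 1 + delta * (`|theta - 1| / k.+1%:R).

(** Here [x] is the value for the choice [i = k] and [S] the sum over the [k] other choices. The
    Ewens average minus the uniform one is [(theta - 1) * (k * x - S)] divided by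
    [(theta + k) * (k + 1)]; the last two hypotheses bound [k * x - S] on either side. *)
Lemma ewens_step (delta x S : R) (k : nat) : 0 <= delta -> 0 <= x -> 0 <= S ->
    k%:R * x - S <= delta * S -> S - k%:R * x <= k%:R * (delta * x) ->
  theta * x + S <= (theta + k%:R) * drift delta k * (k.+1%:R^-1 * (x + S)).
Proof.
move=> d0 x0 S0 h1 h2.
have k1 : 0 < k.+1%:R :> R by rewrite ltr0n.
rewrite -(ler_pM2l k1) /drift.
have -> : k.+1%:R * ((theta + k%:R) * (1 + delta * (`|theta - 1| / k.+1%:R)) *
    (k.+1%:R^-1 * (x + S))) =
    (theta + k%:R) * (x + S) + (theta + k%:R) / k.+1%:R * (delta * `|theta - 1| * (x + S)).
  by field; rewrite nat1r pnatr_eq0.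
have k0 : 0 <= k%:R :> R by rewrite ler0n.
have kS : k.+1%:R = k%:R + 1 :> R by rewrite -natr1.
have pos : 0 <= delta * (x + S) by rewrite mulr_ge0 // addr_ge0.
case: (leP 1 theta) => t1.
  rewrite ger0_norm ?subr_ge0 //.
  have c1 : 1 <= (theta + k%:R) / k.+1%:R by rewrite ler_pdivlMr // kS; lra.
  have t0 : 0 <= theta - 1 by rewrite subr_ge0.
  have : delta * (theta - 1) * (x + S) <=
      (theta + k%:R) / k.+1%:R * (delta * (theta - 1) * (x + S)).
    by rewrite -[leLHS]mul1r ler_wpM2r // -mulrA mulrCA mulr_ge0.
  have := ler_wpM2l t0 h1; have : 0 <= delta * (theta - 1) * x by rewrite !mulr_ge0.
  set T := _ / _ * _; rewrite kS; lra.
rewrite ltr0_norm ?subr_lt0 // opprB.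
have t0 : 0 <= 1 - theta by rewrite subr_ge0 ltW.
case: (leP (k%:R * x) S) => c.
  have : k%:R / k.+1%:R * (delta * (1 - theta) * (x + S)) <=
      (theta + k%:R) / k.+1%:R * (delta * (1 - theta) * (x + S)).
    apply: ler_wpM2r; first by rewrite -mulrA mulrCA mulr_ge0.
    by rewrite ler_wpM2r ?invr_ge0 // lerDr ltW.
  have : (1 - theta) * (k%:R * (delta * x)) <= k%:R / k.+1%:R * (delta * (1 - theta) * (x + S)).
    have hx : k%:R * x <= k%:R / k.+1%:R * (x + S).
      by rewrite mulrAC ler_pdivlMr // kS; have := ler_wpM2l k0 c; lra.
    have := ler_wpM2l (mulr_ge0 t0 d0) hx.
    by congr (_ <= _); ring.
  have := ler_wpM2l t0 h2.
  set T := (theta + _) / _ * _; set U := k%:R / _ * _; rewrite kS; lra.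
have : 0 <= (theta + k%:R) / k.+1%:R * (delta * (1 - theta) * (x + S)).
  apply: mulr_ge0; first by rewrite divr_ge0 // addr_ge0 // ltW.
  by rewrite -mulrA mulrCA mulr_ge0.
have : 0 <= (1 - theta) * (k%:R * x - S) by rewrite mulr_ge0 // subr_ge0 ltW.
set T := (theta + _) / _ * _; rewrite kS; lra.
Qed.

(** Induction on [k] with [H] generalized: the latest transposition is averaged out, which replaces
    [H] by [G], again nonnegative and stable under close changes. The factor [theta ^+ (N - k)]
    counts the points that are still fixed. *)
Lemma ewens_mass_le (delta : R) k (H : 'S_N -> R) : (k <= N)%N -> 0 <= delta ->
    (forall s, 0 <= H s) ->
    (forall s t, close_perms s t -> H s <= (1 + delta) * H t) ->
  ewens_mass k H <= theta ^+ (N - k) * \prod_(j < k) (theta + j%:R) *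
    \prod_(j < k) drift delta j * (k`!%:R^-1 * \sum_(s | fixes_from k s) H s).
Proof.
move=> + d0; elim: k H => [|k IHk] H kN H0 Hclose.
  have fix0 (s : 'S_N) : fixes_from 0 s = (s == 1%g).
    apply/fixes_fromP/eqP => [h|-> x _]; last by rewrite perm1.
    by apply/permP => x; rewrite perm1 h.
  rewrite /ewens_mass !(big_pred1 1%g) // !big_ord0 card_porbits1 fact0 invr1.
  by rewrite subn0 !mulr1 !mul1r.
pose kk := Ordinal kN.
pose G s := k.+1%:R^-1 * \sum_(i : 'I_N | (i <= kk)%N) H (tperm kk i * s)%g.
have G0 s : 0 <= G s by rewrite mulr_ge0 ?invr_ge0 // sumr_ge0.
have Gclose s t : close_perms s t -> G s <= (1 + delta) * G t.
  move=> st; rewrite /G mulrCA; apply: ler_wpM2l; first by rewrite invr_ge0.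
  rewrite big_distrr; apply: ler_sum => i _; apply: Hclose.
  by rewrite close_perms_mull.
have drift0 : 0 <= drift delta k.
  by rewrite addr_ge0 // mulr_ge0 // divr_ge0.
have card_lt : #|[pred i : 'I_N | (i <= kk)%N && (i != kk)]| = k.
  rewrite -[RHS]card_ord -(card_image (f := widen_ord (ltnW kN))); last first.
    by move=> x y /(congr1 val) /= /val_inj.
  apply: eq_card => i; apply/idP/imageP => [|[j _ ->]]; rewrite inE -(inj_eq val_inj) /=.
    by rewrite andbC -ltn_neqAle => ik; exists (Ordinal ik) => //; exact: val_inj.
  by rewrite andbC -ltn_neqAle.
have step s : fixes_from k s ->
    theta ^+ #|porbits s| * H s + \sum_(i : 'I_N | (i <= kk)%N && (i != kk))
       theta ^+ #|porbits (tperm kk i * s)%g| * H (tperm kk i * s)%g <=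
    theta^-1 * ((theta + k%:R) * drift delta k) * (theta ^+ #|porbits s| * G s).
  move=> /fixes_fromP/(_ kk (leqnn _)) skk.
  rewrite (eq_bigr (fun i => theta ^+ #|porbits s| * theta^-1 * H (tperm kk i * s)%g)); last first.
    move=> i /andP[_ ik]; rewrite (porbits_tperm_fixed skk ik) exprSr.
    by rewrite mulfK // gt_eqF.
  rewrite -big_distrr /=; set S := \sum_(i | _) _.
  have GE : G s = k.+1%:R^-1 * (H s + S).
    by rewrite /G (bigD1 kk) //= tperm1 mul1g.
  have hx : theta * H s + S <= (theta + k%:R) * drift delta k * G s.
    have tHs i : close_perms (tperm kk i * s)%g s.
      by have := close_perms_tperm kk i kk s; rewrite tperm1 mul1g.
    have tHs' i : close_perms s (tperm kk i * s)%g.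
      by have := close_perms_tperm kk kk i s; rewrite tperm1 mul1g.
    have kH : k%:R * H s = \sum_(i : 'I_N | (i <= kk)%N && (i != kk)) H s.
      by rewrite sumr_const card_lt mulr_natl.
    rewrite GE; apply: ewens_step => //; first by rewrite sumr_ge0.
      rewrite kH -sumrB big_distrr; apply: ler_sum => i _ /=.
      by have := Hclose _ _ (tHs' i); lra.
    rewrite kH -sumrB mulr_natl -[X in _ *+ X]card_lt -sumr_const; apply: ler_sum => i _ /=.
    by have := Hclose _ _ (tHs i); lra.
  have tp : 0 <= theta ^+ #|porbits s| * theta^-1.
    by rewrite mulr_ge0 ?exprn_ge0 ?invr_ge0 // ltW.
  apply: le_trans (_ : theta ^+ #|porbits s| * theta^-1 * (theta * H s + S) <= _).
    by rewrite mulrDr mulrA divfK // gt_eqF.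
  rewrite [leRHS]mulrACA [theta^-1 * _]mulrC. by apply: ler_wpM2l.
have -> : ewens_mass k.+1 H = \sum_(s | fixes_from k s) (theta ^+ #|porbits s| * H s +
    \sum_(i : 'I_N | (i <= kk)%N && (i != kk))
       theta ^+ #|porbits (tperm kk i * s)%g| * H (tperm kk i * s)%g).
  rewrite /ewens_mass (sum_fixes_fromS kk); apply: eq_bigr => s _.
  by rewrite (bigD1 kk) //= tperm1 mul1g.
apply: le_trans (ler_sum _ _) _; first by move=> s; exact: step.
rewrite -big_distrr /= -/(ewens_mass k G).
apply: le_trans (ler_wpM2l _ (IHk G (ltnW kN) G0 Gclose)) _.
  apply: mulr_ge0; first by rewrite invr_ge0 ltW.
  by apply: mulr_ge0 => //; rewrite addr_ge0 // ltW.
rewrite !big_ord_recr /= (sum_fixes_fromS kk) /G -big_distrr /= factS natrM invfM.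
have -> : (N - k = (N - k.+1).+1)%N by rewrite subnSK.
rewrite exprS le_eqVlt; apply/orP; left; apply/eqP.
set S := \sum_(s | _) _; set P := \prod_(i < k) (theta + _).
move: (drift delta k) (\prod_(i < k) drift delta i) P S (theta ^+ _) => dk Q P S t.
move: (theta + k%:R) (k.+1%:R^-1) (k`!%:R^-1) => u v w.
by field; rewrite gt_eqF.
Qed.

(* The two laws are compared by building the permutation as a product of [N]
   transpositions: at step [k] they differ by a factor [1 + O(delta / k)]. *)
Lemma ewens_le_unif (delta : R) (H : 'S_N -> R) : 0 <= delta ->
    (forall s, 0 <= H s) ->
    (forall s t, close_perms s t -> H s <= (1 + delta) * H t) ->
  \sum_s theta ^+ #|porbits s| / \prod_(j < N) (theta + j%:R) * H s <=
  \prod_(j < N) (1 + delta * (`|theta - 1| / j.+1%:R)) * esp (unif R (N := N)) H.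
Proof.
move=> d0 H0 Hclose; have := ewens_mass_le (leqnn N) d0 H0 Hclose.
have allN (s : 'S_N) : fixes_from N s.
  by apply/fixes_fromP => x; rewrite leqNgt ltn_ord.
rewrite /ewens_mass !(eq_bigl _ _ allN) subnn expr0 mul1r esp_unif => main.
have P0 : 0 < \prod_(j < N) (theta + j%:R).
  by apply: prodr_gt0 => j _; rewrite ltr_wpDr.
under eq_bigr => s _ do rewrite mulrAC.
by rewrite -big_distrl /= ler_pdivrMr // mulrC mulrA.
Qed.

End EwensUniform.

(** * The centered count: moments, Stein bound and stability *)

Lemma leq_bin_exp n k : ('C(n, k) <= n ^ k)%N.
Proof.
apply: leq_trans (_ : n ^_ k <= _)%N.
  by rewrite -bin_ffact leq_pmulr // fact_gt0.
rewrite ffact_prod; apply: leq_trans (_ : \prod_(i < k) n <= _)%N.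
  by apply: leq_prod => i _; exact: leq_subr.
by rewrite prod_nat_const card_ord.
Qed.

Section PatternSum.
Variables (R : realFieldType) (q : nat) (X : {set 'I_q}) (tau : 'S_q.+1) (N : nat).
Let p := q.+1.
Let e := (q - #|X|)%N.

Let I : finType := {l in [pred l : p.-tuple 'I_N | admissible (m := p) X l]}.
Let nb (a b : I) := meets (val a) (val b).

Definition pattern_sum (s : 'S_N) : R :=
  \sum_(l : p.-tuple 'I_N | admissible (m := p) X l) cmatch R tau s (tnth l).

(** The degree bound of [card_admissible_meeting]; the number of blocks is [e.+1]. *)
Definition overlap_bound : R := (p ^ 2 * N ^ e)%:R.

Let pattern_sumE s : pattern_sum s = \sum_(a : I) cmatch R tau s (tnth (val a)).
Proof.
exact: (big_sub [pred l : p.-tuple 'I_N | admissible (m := p) X l]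
  (fun l => cmatch R tau s (tnth l))).
Qed.

Let card_I : #|I| = 'C(N - #|X|, e.+1).
Proof.
have X_le : (#|X| <= q)%N by rewrite -[X in (_ <= X)%N]card_ord max_card.
have := @card_admissible p N X isT; rewrite /p subSn // => <-.
by rewrite card_sig -sum1_card; apply: eq_bigl => l; rewrite inE.
Qed.

Let adm_inj (a : I) : injective (tnth (val a)).
Proof. by apply: increasing_inj; case: a => a /= /admissibleP[]. Qed.

Let nb_deg (a : I) : \sum_(b | nb a b) 1 <= overlap_bound.
Proof.
rewrite -(big_sub_cond [pred l | admissible (m := p) X l] (fun l => meets (val a) l) (fun=> 1)).
rewrite -[1]/(1%N%:R) -natr_sum /overlap_bound ler_nat.
exact: card_admissible_meeting.
Qed.

Let Y (a : I) (s : 'S_N) : R := cmatch R tau s (tnth (val a)).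

Let Y_le1 a s : `|Y a s| <= 1.
Proof. exact: ler_norm_cmatch. Qed.

Let indep1 a (phi : R -> R) :
  esp (unif R (N := N)) (fun s => Y a s * phi (\sum_(b | ~~ nb a b) Y b s)) = 0.
Proof. by apply: esp_cmatch_far => //; exact: adm_inj. Qed.

Let indep2 a b (phi : R -> R) :
  let T s := phi (\sum_(c | ~~ nb a c && ~~ nb b c) Y c s) in
  esp (unif R (N := N)) (fun s => Y a s * Y b s * T s) =
  esp (unif R (N := N)) (fun s => Y a s * Y b s) * esp (unif R (N := N)) T.
Proof. exact: esp_cmatch2_far. Qed.

Let uncorr a b : ~~ nb a b -> esp (unif R (N := N)) (fun s => Y a s * Y b s) = 0.
Proof. by apply: esp_cmatch_uncorr; exact: adm_inj. Qed.

Let bound_le : #|I|%:R * overlap_bound <= (p ^ 2 * N ^ (2 * e).+1)%:R.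
Proof.
rewrite card_I /overlap_bound -natrM ler_nat mulnCA leq_mul2l; apply/orP; right.
have -> : (2 * e).+1 = (e.+1 + e)%N by rewrite mul2n -addnn.
rewrite expnD leq_mul2r (leq_trans (leq_bin_exp _ _)) ?orbT //.
by rewrite leq_exp2r // leq_subr.
Qed.

Let sumE (F : R -> R) :
  esp (unif R (N := N)) (fun s => F (pattern_sum s)) =
  esp (unif R (N := N)) (fun s => F (\sum_a Y a s)).
Proof. by apply: eq_esp => s; rewrite pattern_sumE. Qed.

Lemma pattern_sum_second_moment :
  esp (unif R (N := N)) (fun s => pattern_sum s ^+ 2) <= (p ^ 2 * N ^ (2 * e).+1)%:R.
Proof.
rewrite (sumE (fun x => x ^+ 2)); apply: le_trans bound_le.
exact: (dependency_second_moment (@unif_ge0 R N) (unif_sum R N) Y_le1 nb_deg uncorr).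
Qed.

Lemma pattern_sum_fourth_moment :
  esp (unif R (N := N)) (fun s => pattern_sum s ^+ 4) <=
  8 * (p ^ 6 * N ^ (4 * e + 2))%:R.
Proof.
rewrite (sumE (fun x => x ^+ 4)).
have D0 : 0 <= overlap_bound by rewrite ler0n.
apply: le_trans (dependency_fourth_moment (@unif_ge0 R N) (unif_sum R N) Y_le1 nb_deg
  indep1 uncorr D0) _.
set MD := #|_|%:R * _; pose B : R := (p ^ 2 * N ^ (2 * e).+1)%:R.
have MD0 : 0 <= MD by rewrite mulr_ge0.
have B0 : 0 <= B by rewrite ler0n.
apply: le_trans (_ : B * (5 * B + 3 * overlap_bound ^+ 2) <= _).
  apply: ler_pM => //; first by rewrite addr_ge0 // mulr_ge0 // exprn_ge0.
  by rewrite lerD2r ler_wpM2l.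
pose x : R := (N ^ e)%:R.
have BE : B = p%:R ^+ 2 * (x ^+ 2 * N%:R).
  rewrite /B [(N ^ _)%N]expnS [(2 * e)%N]mulnC [(N ^ (e * 2))%N]expnM.
  by rewrite !natrM !natrX /x natrX; ring.
have -> : 8 * (p ^ 6 * N ^ (4 * e + 2))%:R = 8 * (p%:R ^+ 6 * (x ^+ 4 * N%:R ^+ 2)) :> R.
  by rewrite expnD [(4 * e)%N]mulnC [(N ^ (e * 4))%N]expnM !natrM !natrX /x natrX.
have DE : overlap_bound = p%:R ^+ 2 * x by rewrite /overlap_bound natrM natrX.
(* The term in [overlap_bound ^+ 2] is of lower order in [N]; absorbing it gives the constant
   [5 + 3 = 8]. *)
have NN : N%:R <= N%:R ^+ 2 :> R.
  by rewrite -natrX ler_nat; case: (N) => // n; rewrite leq_pmulr.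
have := ler_wpM2l (_ : 0 <= 3 * (p%:R ^+ 6 * x ^+ 4)) NN.
rewrite BE DE => /(_ ltac:(by rewrite !mulr_ge0 // ?exprn_ge0 // ler0n)).
have : 0 <= 5 * (p%:R ^+ 4 * x ^+ 4 * N%:R ^+ 2) * (p%:R ^+ 2 - 1).
  by rewrite !mulr_ge0 ?subr_ge0 ?exprn_ege1 ?ler1n // ?exprn_ge0 // ler0n.
set n := N%:R; set a := p%:R; lra.
Qed.

Lemma pattern_sum_stein (f g : R -> R) (k eps : R) : 0 < k -> 0 <= eps ->
    (forall x y, `|x - y| <= 2 * overlap_bound / k ->
      `|f x - f y - g x * (x - y)| <= `|x - y| * eps) ->
    (forall x y, `|x - y| <= 2 * overlap_bound / k -> `|g x - g y| <= eps) ->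
  `|esp (unif R (N := N)) (fun s => pattern_sum s / k * f (pattern_sum s / k)) -
    esp (unif R (N := N)) (fun s => pattern_sum s ^+ 2) / k ^+ 2 *
      esp (unif R (N := N)) (fun s => g (pattern_sum s / k))| <=
  3 * (p ^ 2 * N ^ (2 * e).+1)%:R / k ^+ 2 * eps.
Proof.
move=> k0 eps0 hf hg.
rewrite (sumE (fun x => x / k * f (x / k))) (sumE (fun x => x ^+ 2)) (sumE (fun x => g (x / k))).
apply: le_trans (dependency_stein (@unif_ge0 R N) (unif_sum R N) Y_le1 nb_deg
  indep1 indep2 uncorr k0 eps0 hf hg) _.
apply: ler_wpM2r => //; apply: ler_wpM2r; first by rewrite invr_ge0 exprn_ge0 // ltW.
by rewrite ler_wpM2l.
Qed.

Lemma pattern_sum_variance :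
  esp (unif R (N := N)) (fun s => pattern_sum s ^+ 2) =
  \sum_(n < 2 * p) \sum_(AB : p.-tuple 'I_n.+1 * p.-tuple 'I_n.+1 | shape_ok X AB)
    pair_esp R tau AB.1 AB.2 *
      'C(N - #|links X AB.1 :|: links X AB.2|, n.+1 - #|links X AB.1 :|: links X AB.2|)%:R.
Proof.
rewrite -sum_pairs_shapes.
transitivity (\sum_(a : p.-tuple 'I_N | admissible (m := p) X a)
    \sum_(b : p.-tuple 'I_N | admissible (m := p) X b) pair_esp R tau a b).
  under [RHS]eq_bigr => a _ do rewrite -esp_sum.
  rewrite -esp_sum; apply: eq_esp => s; rewrite expr2 {1}/pattern_sum big_distrl /=.
  by apply: eq_bigr => a _; rewrite big_distrr.
rewrite pair_big /= (bigID (fun ab => meets ab.1 ab.2)) /= [X in _ + X]big1 ?addr0.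
  by apply: eq_bigl => ab; rewrite andbA.
move=> [a b] /= /andP[/andP[/admissibleP[/increasing_inj a_inj _] _] far].
exact: esp_cmatch_uncorr.
Qed.

(** A list that avoids the points where [s] and [t] differ matches in both or in neither. There
    remain at most 3 points, [p] coordinates and [N ^ e] lists with a given coordinate at a given
    point. *)
Lemma pattern_sum_close (s t : 'S_N) : close_perms s t ->
  `|pattern_sum s - pattern_sum t| <= (3 * p * N ^ e)%:R.
Proof.
move=> st; rewrite -sumrB; apply: le_trans (ler_norm_sum _ _ _) _.
apply: le_trans (_ : (\sum_(x | s x != t x) \sum_(k < p)
   \sum_(l : p.-tuple 'I_N | admissible (m := p) X l && (tnth l k == x)) 1)%:R <= _).
  apply: le_trans (_ : \sum_(l : p.-tuple 'I_N | admissible (m := p) X l)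
     [exists k, s (tnth l k) != t (tnth l k)]%:R <= _).
    apply: ler_sum => l _; case: existsP => [_|st_eq].
      rewrite /cmatch opprB addrA subrK.
      by case: same_order; case: same_order;
        rewrite /= ?subrr ?normr0 ?subr0 ?sub0r ?normrN ?normr1.
    rewrite (_ : cmatch R tau s _ = cmatch R tau t (tnth l)) ?subrr ?normr0 //.
    congr ((nat_of_bool _)%:R - _); apply: eq_forallb => j; apply: eq_forallb => k.
    have E i : s (tnth l i) = t (tnth l i).
      by apply/eqP; apply: contraT => h; case: st_eq; exists i.
    by rewrite !E.
  rewrite -natr_sum ler_nat pair_big /=.
  rewrite (exchange_big_dep (fun l => admissible (m := p) X l)) /=; last first.
    by move=> ? ? _ /andP[].
  apply: leq_sum => l al; case: existsP => // -[k sk] /=.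
  by rewrite (bigD1 (tnth l k, k)) //= sk al eqxx.
rewrite ler_nat; apply: leq_trans (_ : \sum_(x | s x != t x) (p * N ^ e) <= _)%N.
  apply: leq_sum => x _; rewrite -[p in (p * _)%N]card_ord -sum_nat_const.
  by apply: leq_sum => k _; exact: card_admissible_through.
by rewrite sum_nat_const -mulnA leq_mul2r [(_ <= 3)%N]st orbT.
Qed.

Lemma sum_same_order (s : 'S_N) :
  \sum_(l : p.-tuple 'I_N | admissible (m := p) X l) (same_order tau s (tnth l))%:R =
  pattern_sum s + 'C(N - #|X|, e.+1)%:R / p`!%:R.
Proof.
rewrite -card_I mulr_natl.
have -> : p`!%:R^-1 *+ #|I| =
    \sum_(l : p.-tuple 'I_N | admissible (m := p) X l) (p`!%:R^-1 : R).
  by rewrite sumr_const card_sig.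
by rewrite -big_split; apply: eq_bigr => l _; rewrite /= /cmatch subrK.
Qed.

End PatternSum.

From mathcomp Require Import all_classical all_reals all_analysis.
From mathcomp Require Import measurable_realfun.

Import Order.TTheory GRing.Theory Num.Theory.
Import numFieldNormedType.Exports.

Local Open Scope classical_set_scope.
Local Open Scope ring_scope.

(** * Compactly supported test functions *)

Section CompactlySupported.
Variable R : realType.
Implicit Types (f g h : R -> R) (L K : R).

Definition supported_in L h := continuous h /\ forall x, L <= `|x| -> h x = 0.

Definition lipschitz K h := forall x y, `|h x - h y| <= K * `|x - y|.

Lemma continuous_close h x e : 0 < e -> {for x, continuous h} ->
  exists2 d, 0 < d & forall y, `|x - y| < d -> `|h x - h y| < e.
Proof.
move=> e0 /cvgrPdist_lt /(_ e e0); rewrite -nbhs_nearE => /nbhs_ballP[d d0 hd].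
by exists d => // y xy; exact: hd.
Qed.

Lemma lipschitz_continuous K h : lipschitz K h -> continuous h.
Proof.
move=> hK x; apply/cvgrPdist_lt => e e0.
have K1 : 0 < `|K| + 1 by rewrite ltr_wpDl.
near=> y.
apply: le_lt_trans (hK x y) _.
apply: le_lt_trans (_ : (`|K| + 1) * `|x - y| < e).
  by apply: ler_wpM2r => //; rewrite (le_trans (ler_norm K)) // lerDl.
rewrite mulrC -ltr_pdivlMr //.
by near: y; apply: cvgr_dist_lt => //; exact: divr_gt0.
Unshelve. all: by end_near. Qed.

(** Heine's theorem on a segment larger than the support by a margin 1: if [x] leaves the segment, a
    close [y] still lies where [h] vanishes. *)
Lemma supported_unif_continuous L h : supported_in L h -> forall e, 0 < e ->
  exists2 d, 0 < d & forall x y, `|x - y| <= d -> `|h x - h y| <= e.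
Proof.
move=> [hc h0] e e0.
pose P (d x : R) := forall y, `|x - y| < d -> `|h x - h y| <= e.
have cov := (compact_near_coveringP _).1 (@segment_compact R (- (`|L| + 1)) (`|L| + 1)).
have : \forall d \near 0^'+, `[- (`|L| + 1), `|L| + 1] `<=` P d.
  apply: cov => x _; have e2 : 0 < e / 2 by rewrite divr_gt0.
  have [d d0 hd] := continuous_close e2 (hc x).
  have d2 : 0 < d / 2 by rewrite divr_gt0.
  exists (ball x (d / 2), [set d' | d' <= d / 2]) => /=.
    by split; [exact: nbhsx_ballx | exact: nbhs_right_le].
  move=> [x' d'] /= [xx' dd'] y x'y.
  have hx' : `|h x - h x'| < e / 2 by apply: hd; rewrite (lt_trans xx') //; lra.
  have hy : `|h x - h y| < e / 2.
    apply: hd; rewrite (le_lt_trans (ler_distD x' _ _)) //.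
    have h1 : `|x - x'| < d / 2 := xx'; have h2 : d' <= d / 2 := dd'.
    by lra.
  by rewrite (le_trans (ler_distD (h x) _ _)) // distrC; lra.
move=> /nbhs_right0P; rewrite -nbhs_nearE => /nbhs_ballP[d d0 /= hd].
have dpos : 0 < d := d0.
pose d' := Num.min (d / 2) (1 / 2).
have d'0 : 0 < d' by rewrite lt_min !divr_gt0.
exists (d' / 2); first by rewrite divr_gt0.
move=> x y xy.
have [xL|xL] := leP (`|x|) (`|L| + 1).
  apply: (hd d') => //=.
    by rewrite /ball /= sub0r normrN gtr0_norm // /d' gt_min; apply/orP; left; lra.
    by rewrite in_itv /= -ler_norml.
  by rewrite (le_lt_trans xy) //; lra.
have d'1 : d' <= 1 / 2 by rewrite ge_min lexx orbT.
rewrite (h0 x) ?(h0 y) ?subrr ?normr0 ?ltW //.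
  have := ler_norm L; have := ler_distD y x 0; rewrite !subr0; lra.
by have := ler_norm L; lra.
Qed.

Lemma supported_bounded L h : supported_in L h -> exists2 B, 0 <= B & forall x, `|h x| <= B.
Proof.
move=> [hc h0].
have cn : {within `[- `|L|, `|L|], continuous (fun x => `|h x|)}.
  by apply: continuous_subspaceT => x; apply: cvg_norm; exact: hc.
have LL : - `|L| <= `|L| by rewrite (le_trans _ (normr_ge0 L)) // oppr_le0.
have [c _ hmax] := EVT_max LL cn.
exists `|h c| => // x; have [xL|xL] := leP (`|x|) `|L|.
  by apply: hmax; rewrite in_itv /= -ler_norml.
by rewrite h0 ?normr0 // (le_trans (ler_norm L)) // ltW.
Qed.

(** A trapezoidal cutoff, used both to truncate test functions and to measure the mass of tails. *)
Definition plateau L (x : R) : R := Num.max 0 (Num.min 1 (L + 1 - `|x|)).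

Lemma plateau_ge0 L x : 0 <= plateau L x.
Proof. by rewrite le_max lexx. Qed.

Lemma plateau_le1 L x : plateau L x <= 1.
Proof. by rewrite ge_max ler01 ge_min lexx. Qed.

Lemma plateau1 L x : `|x| <= L -> plateau L x = 1.
Proof.
move=> xL; rewrite /plateau min_l; last by lra.
by rewrite max_r.
Qed.

Lemma plateau_lipschitz L : lipschitz 1 (plateau L).
Proof.
move=> x y; rewrite mul1r.
have h : `|(`|x| - `|y|)| <= `|x - y| by exact: ler_dist_dist.
rewrite /plateau; move: h; move: `|x - y| => d.
rewrite !ler_norml => /andP[h1 h2].
case: (leP 1 (L + 1 - `|x|)) => hx; case: (leP 1 (L + 1 - `|y|)) => hy.
- by apply/andP; split; lra.
- by case: (leP 0 1) => ?; case: (leP 0 (L + 1 - `|y|)) => ?; apply/andP; split; lra.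
- by case: (leP 0 1) => ?; case: (leP 0 (L + 1 - `|x|)) => ?; apply/andP; split; lra.
- by case: (leP 0 (L + 1 - `|x|)) => ?; case: (leP 0 (L + 1 - `|y|)) => ?;
    apply/andP; split; lra.
Qed.

Lemma plateau_supported L : supported_in (L + 1) (plateau L).
Proof.
split; first exact: lipschitz_continuous (plateau_lipschitz L).
move=> x xL; rewrite /plateau min_r; last by have := normr_ge0 x; lra.
by rewrite max_l //; lra.
Qed.

Lemma supportedM L h g : supported_in L h -> continuous g ->
  supported_in L (fun x => g x * h x).
Proof.
move=> [hc h0] gc; split => [x|x /h0 ->]; last by rewrite mulr0.
by apply: cvgM; [exact: gc | exact: hc].
Qed.

Lemma supported_ge L L' h : L <= L' -> supported_in L h -> supported_in L' h.
Proof. by move=> LL' [hc h0]; split => // x /(le_trans LL')/h0. Qed.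

End CompactlySupported.

(** * Means on the line, the normal law and Stein's equation *)

Section ProbabilityOnLine.
Variables (R : realType) (nu : probability (measurableTypeR R) R).

Definition mean (h : R -> R) : R := (\int[nu]_x h x)%R.

Lemma bounded_continuous_integrable (h : R -> R) B :
  continuous h -> (forall x, `|h x| <= B) -> nu.-integrable setT (EFin \o h).
Proof.
move=> hc hB; apply: measurable_bounded_integrable => //.
- by have /= -> := probability_setT nu; rewrite ltry.
- exact: continuous_measurable_fun.
- exists B; split; first exact: num_real.
  by move=> M BM x _ /=; rewrite (le_trans (hB x)) // ltW.
Qed.

Lemma ler_norm_mean (h : R -> R) B :
  continuous h -> (forall x, `|h x| <= B) -> `|mean h| <= B.
Proof.
move=> hc hB; have ih := bounded_continuous_integrable hc hB.
apply: le_trans (le_normr_Rintegral _ ih) _ => //.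
have iB : nu.-integrable setT (EFin \o cst B).
  by apply: (@bounded_continuous_integrable _ `|B|) => // x; exact: cvg_cst.
apply: le_trans (_ : (\int[nu]_x (cst B x))%R <= _).
  apply: le_Rintegral => //; apply: (@bounded_continuous_integrable _ B) => [x|x].
    by apply: cvg_norm; exact: hc.
  by rewrite normr_id.
by rewrite Rintegral_cst //; have /= -> := probability_setT nu; rewrite mulr1.
Qed.

(** Tightness of a single law, by dominated convergence along integer widths. The lower bound [A]
    leaves room for other requirements on [L]. *)
Lemma plateau_mean e (A : R) : 0 < e -> exists2 L, A <= L & `|1 - mean (plateau L)| <= e.
Proof.
move=> e0.
have cst1 : nu.-integrable setT (EFin \o cst (1 : R)).
  by apply: (@bounded_continuous_integrable _ 1) => [x|x /=]; [exact: cvg_cst | rewrite normr1].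
have plc L : continuous (@plateau R L) by have [] := plateau_supported L.
have pl1 x : (plateau n%:R x)%:E @[n --> \oo] --> (1 : \bar R)%E.
  apply: cvg_near_cst; exists (Num.truncn `|x|).+1 => // n /= nx; congr (_%:E).
  by rewrite plateau1 // ltW // (lt_le_trans (Num.Theory.truncnS_gt _)) // ler_nat.
pose pl n (x : measurableTypeR R) : \bar R := (plateau n%:R x)%:E.
have ae1 : {ae nu, forall x, setT x -> pl ^~ x @ \oo --> (cst 1%E : measurableTypeR R -> \bar R) x}.
  by apply: aeW => x _; exact: pl1.
have ae2 : {ae nu, forall x n, setT x -> (`|pl n x| <= cst 1 x)%E}.
  by apply: aeW => x n _; rewrite lee_fin ger0_norm ?plateau_ge0 ?plateau_le1.
have mpl n : measurable_fun setT (pl n).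
  by apply/measurable_EFinP; exact: continuous_measurable_fun.
have [_ _] := dominated_convergence measurableT mpl (measurable_cst _) ae1 cst1 ae2.
rewrite integral_cst //; have /= -> := probability_setT nu; rewrite mule1 => /fine_cvg /= cv.
have cv' : mean (plateau n%:R) @[n --> \oo] --> (1 : R) := cv.
have : \forall n \near \oo, `|1 - mean (plateau n%:R)| <= e /\ A <= n%:R.
  near=> n; split; first by near: n; exact: cvgr_dist_le.
  by near: n; exact: nbhs_infty_ger.
by move=> [n _ /(_ n (leqnn n)) /= [h1 h2]]; exists n%:R.
Unshelve. all: by end_near. Qed.

End ProbabilityOnLine.

Section Normal.
Variables (R : realType) (s : R).
Hypothesis s_gt0 : 0 < s.
Notation mu := (@lebesgue_measure R).
Let s_neq0 : s != 0. Proof. by rewrite gt_eqF. Qed.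

Lemma mean_normal (h : R -> R) B : continuous h -> (forall x, `|h x| <= B) ->
  mean (normal_prob 0 s) h = (\int[mu]_x (h x * normal_pdf 0 s x))%R.
Proof.
move=> hc hB; congr fine.
have ih := bounded_continuous_integrable (normal_prob 0 s) hc hB.
rewrite -(Radon_Nikodym_change_of_variables (normal_prob_dominates 0 s)) //=.
have mh : measurable_fun setT (EFin \o h).
  by apply/measurable_EFinP; exact: continuous_measurable_fun.
have mpdf : measurable_fun setT (EFin \o normal_pdf 0 s).
  by apply/measurable_EFinP; exact: measurable_normal_pdf.
apply: ae_eq_integral => //.
- apply: emeasurable_funM => //; apply: (measurable_int mu).
  by apply: Radon_Nikodym_integrable; exact: normal_prob_dominates.
- by under eq_fun do rewrite EFinM; exact: emeasurable_funM.
- under [X in ae_eq _ _ _ X]eq_fun do rewrite EFinM.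
  apply: ae_eqe_mul2l => /=.
  rewrite Radon_NikodymE//=; first exact: normal_prob_dominates.
  move=> dom; case: cid => /= f [h1 h2 h3].
  apply: integral_ae_eq => //=.
  by move=> E _ mE; rewrite -h3.
Qed.

(** [F] is the primitive from minus infinity of [u] times the density, and [f] multiplies it by the
    reciprocal [E] of the density. Outside the support of [u], [F] is 0 on the left and the whole
    integral on the right, which vanishes because [u] is centered. *)
Lemma stein_solution L (u : R -> R) : supported_in L u ->
    mean (normal_prob 0 s) u = 0 ->
  exists f g : R -> R, [/\ forall x, is_derive x (1 : R) f (g x),
    supported_in L f, supported_in L g &
    forall x, s ^+ 2 * g x - x * f x = s ^+ 2 * u x].
Proof.
move=> supu; have [uc u0] := supu; have [B B0 uB] := supported_bounded supu.
rewrite (mean_normal uc uB).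
pose G x := u x * normal_pdf 0 s x.
have Gc : continuous G.
  by move=> x; apply: cvgM; [exact: uc | exact: continuous_normal_pdf].
have iG : mu.-integrable setT (EFin \o G).
  apply: (@le_integrable _ _ _ mu setT measurableT _
    (fun x => (B * normal_pdf 0 s x)%:E)).
  - by apply/measurable_EFinP; exact: continuous_measurable_fun.
  - move=> x _; rewrite lee_fin normrM [leRHS]normrM.
    by rewrite (ger0_norm B0) ler_wpM2r.
  - under eq_fun do rewrite EFinM; apply: integrableZl => //.
    exact: integrable_normal_pdf.
have iGs (A : set R) : measurable A -> mu.-integrable A (EFin \o G).
  by move=> mA; exact: integrableS iG.
move=> intG0.
pose F x := (\int[mu]_(t in `]-oo, x]) G t)%R.
have dF x : is_derive x (1 : R) F (G x).
  have xu : x < x + 1 by rewrite ltrDl.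
  have [d1 d2] : derivable F x 1 /\ derive1 F x = G x.
    apply: (@continuous_FTC1 R G -oo%O x (x + 1) xu (iGs _ (measurable_itv _))) => //;
      [by rewrite ltNyr | exact: Gc].
  by rewrite -d2 derive1E; exact: derivableP.
have F0 x : L <= `|x| -> F x = 0.
  move=> Lx; have [x0|x0] := leP 0 x.
    have xL : L <= x by rewrite ger0_norm in Lx.
    rewrite -intG0 /F Rintegral_mkcond; apply: eq_Rintegral => t _.
    rewrite /patch; case: ifPn => //; rewrite notin_setE /= in_itv /= => /negP.
    rewrite -ltNge => xt; rewrite /G u0 ?mul0r // ger0_norm; last by rewrite (le_trans x0) // ltW.
    by rewrite (le_trans xL) // ltW.
  rewrite /F; under eq_Rintegral => t.
    rewrite inE /= in_itv /= => tx.
    rewrite /G u0 ?mul0r; last first.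
      rewrite ltr0_norm in Lx => //; rewrite ler0_norm; last by rewrite (le_trans tx) // ltW.
      by rewrite (le_trans Lx) // lerN2.
    over.
  by rewrite Rintegral_cst // mul0r.
pose E (x : R) := (normal_peak s)^-1 * expR (x ^+ 2 / (s ^+ 2 *+ 2)).
have dE x : is_derive x (1 : R) E (x / s ^+ 2 * E x).
  have d1 : is_derive x (1 : R) (fun y : R => (s ^+ 2 *+ 2)^-1 *: y ^+ 2) (x / s ^+ 2).
    apply: is_derive_eq.
    by rewrite /GRing.scale /= !mulr1 -mulr_natr; field.
  have d2 : is_derive x (1 : R) (expR \o (fun y : R => (s ^+ 2 *+ 2)^-1 *: y ^+ 2))
     (expR ((s ^+ 2 *+ 2)^-1 *: x ^+ 2) * (x / s ^+ 2)) by apply: is_derive1_comp.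
  have EE : E = (normal_peak s)^-1 \*: (expR \o (fun y : R => (s ^+ 2 *+ 2)^-1 *: y ^+ 2)).
    by apply/funext => y; rewrite /E /= [y ^+ 2 / _]mulrC.
  rewrite [X in is_derive _ _ X]EE; apply: is_derive_eq.
  by rewrite /GRing.scale /E /= [x ^+ 2 / _]mulrC [RHS]mulrC -[RHS]mulrA.

have Epdf x : E x * normal_pdf 0 s x = 1.
  rewrite normal_pdfE // /E /normal_fun subr0 mulrACA mulVf ?mul1r.
    by rewrite -expRD mulNr subrr expR0.
  by rewrite gt_eqF // normal_peak_gt0.
pose f x := E x * F x.
pose g x := x / s ^+ 2 * f x + u x.
have df x : is_derive x (1 : R) f (g x).
  have := is_deriveM (dE x) (dF x).
  rewrite (_ : E x *: G x + F x *: (x / s ^+ 2 * E x) = g x) //.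
  by rewrite /g /f /GRing.scale /= /G mulrCA Epdf; ring.
have fc : continuous f.
  by move=> x; apply/differentiable_continuous/derivable1_diffP; have [] := df x.
have f0 x : L <= `|x| -> f x = 0 by move=> /F0 h; rewrite /f h mulr0.
exists f, g; split => //.
- split => [x|x Lx]; last by rewrite /g f0 // u0 // mulr0 addr0.
  apply: cvgD; last exact: uc.
  apply: cvgM; last exact: fc.
  by apply: cvgM; [exact: cvg_id | exact: cvg_cst].
- by move=> x; rewrite /g; field.
Qed.

End Normal.

(** * Reductions between classes of test functions *)

Section LipschitzApproximation.
Variables (R : realType) (h : R -> R) (B : R).
Hypothesis h_bounded : forall x, `|h x| <= B.

(** For [K >= 0], the largest [K]-Lipschitz function below [h]. *)
Definition inf_convolution (K x : R) : R := inf [set h y + K * `|x - y| | y in setT].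

Let inf_conv_has_inf K x : 0 <= K -> has_inf [set h y + K * `|x - y| | y in setT].
Proof.
move=> K0; split; first by exists (h x + K * `|x - x|); exists x.
exists (- B) => _ [y _ <-]; have := mulr_ge0 K0 (normr_ge0 (x - y)).
by have := h_bounded y; rewrite ler_norml => /andP[? _]; lra.
Qed.

Let inf_conv_le K x y : 0 <= K -> inf_convolution K x <= h y + K * `|x - y|.
Proof. by move=> K0; apply: ge_inf; [exact: (inf_conv_has_inf x K0).2 | exists y]. Qed.

Lemma inf_convolution_lipschitz K : 0 <= K -> lipschitz K (inf_convolution K).
Proof.
move=> K0.
have half x y : inf_convolution K x - K * `|x - y| <= inf_convolution K y.
  apply: lb_le_inf; first exact: (inf_conv_has_inf y K0).1.
  move=> _ [z _ <-]; rewrite lerBlDr; apply: le_trans (inf_conv_le x z K0) _.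
  have := ler_wpM2l K0 (ler_distD y x z); rewrite mulrDr; lra.
move=> x y; rewrite ler_norml; apply/andP; split.
  by have := half y x; rewrite distrC; lra.
by have := half x y; lra.
Qed.

(** With [K = 2 * B / d], a point farther than [d] pays a penalty at least [2 * B], which no drop of
    [h] can offset; nearer points are handled by the modulus of continuity. *)
Lemma inf_convolution_close e d : 0 < e -> 0 < d ->
  (forall x y, `|x - y| <= d -> `|h x - h y| <= e) ->
  exists2 K, 0 <= K & forall x, `|h x - inf_convolution K x| <= e.
Proof.
move=> e0 d0 hd; pose K := 2 * B / d.
have B0 : 0 <= B by apply: le_trans (h_bounded 0).
have K0 : 0 <= K by rewrite divr_ge0 ?mulr_ge0 // ltW.
exists K => // x; rewrite ger0_norm; last first.
  by have := inf_conv_le x x K0; rewrite subrr normr0 mulr0 addr0 subr_ge0.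
rewrite lerBlDr -lerBlDl; apply: lb_le_inf; first exact: (inf_conv_has_inf x K0).1.
move=> _ [y _ <-]; have := mulr_ge0 K0 (normr_ge0 (x - y)).
have [xy|xy] := leP (`|x - y|) d.
  by have := hd x y xy; rewrite ler_norml => /andP[_]; lra.
move=> _; have h1 : 2 * B <= K * `|x - y|.
  by rewrite /K mulrAC ler_pdivlMr // ler_wpM2l ?mulr_ge0 // ltW.
have := h_bounded x; have := h_bounded y; rewrite !ler_norml => /andP[? ?] /andP[? ?]; lra.
Qed.

End LipschitzApproximation.

Section MeanLinear.
Variables (R : realType) (nu : probability (measurableTypeR R) R).
Implicit Types f g : R -> R.

Definition bounded_continuous f := continuous f /\ exists B, forall x, `|f x| <= B.

Lemma bounded_continuousB f g : bounded_continuous f -> bounded_continuous g ->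
  bounded_continuous (fun x => f x - g x).
Proof.
move=> [fc [Bf fB]] [gc [Bg gB]]; split.
  by move=> x; apply: cvgB; [exact: fc | exact: gc].
by exists (Bf + Bg) => x; rewrite (le_trans (ler_normB _ _)) // lerD.
Qed.

Lemma bounded_continuousZ c f : bounded_continuous f -> bounded_continuous (fun x => c * f x).
Proof.
move=> [fc [Bf fB]]; split; last by exists (`|c| * Bf) => x; rewrite normrM ler_wpM2l.
by move=> x; apply: cvgM; [exact: cvg_cst | exact: fc].
Qed.

Lemma bounded_continuous_cst c : bounded_continuous (fun=> c : R).
Proof. by split; [move=> x; exact: cvg_cst | exists `|c|]. Qed.

Lemma supported_bounded_continuous L f : supported_in L f -> bounded_continuous f.
Proof.
by move=> fL; split; [case: fL | have [B _ fB] := supported_bounded fL; exists B].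
Qed.

Lemma bounded_lipschitz_continuous K B f : lipschitz K f -> (forall x, `|f x| <= B) ->
  bounded_continuous f.
Proof. by move=> /lipschitz_continuous fc fB; split => //; exists B. Qed.

Let int f : bounded_continuous f -> nu.-integrable setT (EFin \o f).
Proof. by move=> [fc [B fB]]; exact: bounded_continuous_integrable fc fB. Qed.

Lemma meanB f g : bounded_continuous f -> bounded_continuous g ->
  mean nu (fun x => f x - g x) = mean nu f - mean nu g.
Proof. by move=> /int fi /int gi; exact: RintegralB. Qed.

Lemma meanZ c f : bounded_continuous f -> mean nu (fun x => c * f x) = c * mean nu f.
Proof. by move=> /int fi; exact: RintegralZl. Qed.

Lemma mean_cst c : mean nu (fun=> c) = c.
Proof.
by rewrite /mean Rintegral_cst //; have /= -> := probability_setT nu; rewrite mulr1.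
Qed.

Lemma le_mean f g : bounded_continuous f -> bounded_continuous g ->
  (forall x, f x <= g x) -> mean nu f <= mean nu g.
Proof. by move=> /int fi /int gi fg; apply: le_Rintegral. Qed.

Lemma ler_norm_mean_le f g : bounded_continuous f -> bounded_continuous g ->
  (forall x, `|f x| <= g x) -> `|mean nu f| <= mean nu g.
Proof.
move=> fb gb fg; rewrite ler_norml; apply/andP; split.
  rewrite -mulN1r -meanZ //; apply: le_mean => // [|x]; first exact: bounded_continuousZ.
  by have := fg x; rewrite ler_norml => /andP[? _]; rewrite mulN1r.
by apply: le_mean => // x; rewrite (le_trans (ler_norm _)).
Qed.

End MeanLinear.

Section Portmanteau.
Variables (R : realType) (E : nat -> (R -> R) -> R).
Hypothesis EB : forall n f g, E n (fun x => f x - g x) = E n f - E n g.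
Hypothesis EZ : forall n c f, E n (fun x => c * f x) = c * E n f.
Hypothesis Ecst : forall n c, E n (fun=> c) = c.
Hypothesis E_le : forall n f g, (forall x, `|f x| <= g x) -> `|E n f| <= E n g.
Variable nu : probability (measurableTypeR R) R.

(** No mass escapes, because the limit is a probability: a wide plateau has a limiting mean close to
    1, which controls the tails of [E n] for large [n]. The [E n] model expectations under finitely
    supported laws, whence their linearity on all functions. *)
Lemma cvg_from_supported :
  (forall L h, supported_in L h -> E n h @[n --> \oo] --> mean nu h) ->
  forall f, bounded_continuous f -> E n f @[n --> \oo] --> mean nu f.
Proof.
move=> cv f fb; have [fc [B fB]] := fb.
have B0 : 0 <= B by apply: le_trans (fB 0).
apply/cvgrPdist_le => e e0.
(* The three errors [B * e'], [e'] and [2 * B * e'] have to add up to at most [e]. *)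
have e'0 : 0 < e / (4 * (B + 1)) by rewrite divr_gt0 // mulr_gt0 // ltr_wpDl.
set e' := e / _ in e'0.
have e'e : 4 * (B + 1) * e' = e.
  by rewrite /e' mulrC divfK // gt_eqF // mulr_gt0 // ltr_wpDl.
have [L _ hL] := plateau_mean nu 0 e'0.
have psup := plateau_supported L.
have pb := supported_bounded_continuous psup.
have fpsup := supportedM psup fc.
have fpb := supported_bounded_continuous fpsup.
have close x : `|f x - f x * plateau L x| <= B - B * plateau L x.
  have -> : f x - f x * plateau L x = f x * (1 - plateau L x) by ring.
  have -> : B - B * plateau L x = B * (1 - plateau L x) by ring.
  rewrite normrM.
  apply: ler_pM => //; rewrite ger0_norm ?subr_ge0 ?plateau_le1 //.
have m1 : `|mean nu f - mean nu (fun x => f x * plateau L x)| <= B * e'.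
  rewrite -meanB //; apply: le_trans (ler_norm_mean_le nu _ _ close) _.
  - exact: bounded_continuousB.
  - by apply: bounded_continuousB; [exact: bounded_continuous_cst | exact: bounded_continuousZ].
  rewrite meanB ?mean_cst ?meanZ //; last 2 first.
  - exact: bounded_continuous_cst.
  - exact: bounded_continuousZ.
  have -> : B - B * mean nu (plateau L) = B * (1 - mean nu (plateau L)) by ring.
  by rewrite ler_wpM2l // (le_trans _ hL) // ler_norm.
near=> n.
have c1 : `|mean nu (fun x => f x * plateau L x) - E n (fun x => f x * plateau L x)| <= e'.
  by near: n; apply: cvgr_dist_le => //; exact: cv fpsup.
have c2 : `|mean nu (plateau L) - E n (plateau L)| <= e'.
  by near: n; apply: cvgr_dist_le => //; exact: cv psup.
have m2 : `|E n f - E n (fun x => f x * plateau L x)| <= B * (2 * e').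
  rewrite -EB; apply: le_trans (E_le n close) _.
  rewrite EB Ecst EZ.
  have -> : B - B * E n (plateau L) = B * (1 - E n (plateau L)) by ring.
  rewrite ler_wpM2l //.
  by move: c2 hL; rewrite !ler_norml => /andP[? ?] /andP[? ?]; lra.
have -> : mean nu f - E n f = (mean nu f - mean nu (fun x => f x * plateau L x)) +
    (mean nu (fun x => f x * plateau L x) - E n (fun x => f x * plateau L x)) -
    (E n f - E n (fun x => f x * plateau L x)) by ring.
rewrite (le_trans (ler_normB _ _)) // (le_trans (lerD (ler_normD _ _) (lexx _))) //.
apply: le_trans (lerD (lerD m1 c1) m2) _.
by rewrite -e'e; have := mulr_ge0 B0 (ltW e'0); lra.
Unshelve. all: by end_near. Qed.

(** Inf-convolution approximates a compactly supported function uniformly, and a uniform error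
    passes through every [E n]. *)
Lemma cvg_from_lipschitz :
  (forall K B h, lipschitz K h -> (forall x, `|h x| <= B) ->
     E n h @[n --> \oo] --> mean nu h) ->
  forall L f, supported_in L f -> E n f @[n --> \oo] --> mean nu f.
Proof.
move=> cv L f fsup; have [B B0 fB] := supported_bounded fsup.
have fb := supported_bounded_continuous fsup.
apply/cvgrPdist_le => e e0; have e3 : 0 < e / 3 by rewrite divr_gt0.
have [d d0 hd] := supported_unif_continuous fsup e3.
have [K K0 hK] := inf_convolution_close fB e3 d0 hd.
set k := inf_convolution f K in hK.
have kK : lipschitz K k by exact: inf_convolution_lipschitz K0.
have kB x : `|k x| <= B + e / 3.
  have -> : k x = f x - (f x - k x) by ring.
  by rewrite (le_trans (ler_normB _ _)) // lerD.
have kb := bounded_lipschitz_continuous kK kB.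
near=> n.
have c1 : `|mean nu k - E n k| <= e / 3.
  by near: n; apply: cvgr_dist_le => //; exact: cv kK kB.
have m1 : `|mean nu f - mean nu k| <= e / 3.
  by rewrite -meanB //; have [c _] := bounded_continuousB fb kb; exact: ler_norm_mean.
have m2 : `|E n f - E n k| <= e / 3.
  by rewrite -EB -[leRHS](Ecst n); exact: E_le.
have -> : mean nu f - E n f = (mean nu f - mean nu k) + (mean nu k - E n k) - (E n f - E n k).
  by ring.
rewrite (le_trans (ler_normB _ _)) // (le_trans (lerD (ler_normD _ _) (lexx _))) //.
by apply: le_trans (lerD (lerD m1 c1) m2) _; lra.
Unshelve. all: by end_near. Qed.

End Portmanteau.

(** * From Stein's identity, or a vanishing second moment, to the limit law *)

Section SteinConvergence.
Variables (R : realType) (E : nat -> (R -> R) -> R).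
Hypothesis EB : forall n f g, E n (fun x => f x - g x) = E n f - E n g.
Hypothesis EZ : forall n c f, E n (fun x => c * f x) = c * E n f.
Hypothesis Ecst : forall n c, E n (fun=> c) = c.
Hypothesis E_le : forall n f g, (forall x, `|f x| <= g x) -> `|E n f| <= E n g.
Variable C : R.
Hypothesis E_sqr : forall n, E n (fun x => x ^+ 2) <= C.

(** Chebyshev's inequality with a plateau in place of an indicator. *)
Let tail n L : 0 < L -> `|1 - E n (plateau L)| <= C / L ^+ 2.
Proof.
move=> L0; have L2 : 0 < L ^+ 2 by rewrite exprn_gt0.
rewrite -(Ecst n 1) -EB.
apply: le_trans (_ : E n (fun x => (L ^+ 2)^-1 * x ^+ 2) <= _).
  apply: E_le => x; rewrite ger0_norm ?subr_ge0 ?plateau_le1 //.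
  have [xL|xL] := leP `|x| L; first by rewrite plateau1 // subrr mulr_ge0 ?invr_ge0 ?sqr_ge0 // ltW.
  apply: le_trans (_ : 1 <= _); first by rewrite gerBl plateau_ge0.
  rewrite mulrC ler_pdivlMr // mul1r -(real_normK (num_real x)).
  by rewrite lerXn2r ?nnegrE ?normr_ge0 // ltW.
by rewrite EZ mulrC ler_wpM2r // invr_ge0 ltW.
Qed.

(* Subtracting a multiple of a wide plateau from [h] makes its Gaussian mean
   vanish, which forces the Stein solution to have compact support; tightness
   then controls the plateau itself. *)
Lemma cvg_from_stein s : 0 < s ->
  (forall L f g, (forall x, is_derive x (1 : R) f (g x)) -> supported_in L f ->
     supported_in L g ->
     E n (fun x => x * f x) - s ^+ 2 * E n g @[n --> \oo] --> (0 : R)) ->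
  forall L h, supported_in L h -> E n h @[n --> \oo] --> mean (normal_prob 0 s) h.
Proof.
move=> s0 stein L h hsup; set nu : probability _ R := normal_prob 0 s.
have hb := supported_bounded_continuous hsup.
apply/cvgrPdist_le => e e0.
pose m := `|mean nu h|.
have m0 : 0 <= m by exact: normr_ge0.
(* The bound 1/2 keeps the mean of the plateau away from 0, so that [|c| <= 2 * m]; the other bound
   makes the final error [2 * m * (2 * e')] at most [e / 2]. *)
have e'0 : 0 < Num.min (1 / 2) (e / (8 * (m + 1))).
  by rewrite lt_min !divr_gt0 // mulr_gt0 // ltr_wpDl.
set e' := Num.min _ _ in e'0.
have e'2 : e' <= 1 / 2 by rewrite ge_min lexx.
have e'e : 8 * (m * e') <= e.
  have : e' <= e / (8 * (m + 1)) by rewrite ge_min lexx orbT.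
  by rewrite ler_pdivlMr ?mulr_gt0 ?ltr_wpDl //; lra.
(* The plateau has to cover the support of [h] and satisfy [C / L' ^+ 2 <= e']; for the latter,
   [L' >= 1] and [L' >= C / e'] suffice. *)
pose A := Num.max `|L| (Num.max 1 (C / e')).
have [L' AL' hL'] := plateau_mean nu A e'0.
have L'1 : 1 <= L' by rewrite (le_trans _ AL') // !le_max lexx orbT.
have L'C : C / L' ^+ 2 <= e'.
  have L'0 : 0 < L' by rewrite (lt_le_trans ltr01).
  rewrite ler_pdivrMr ?exprn_gt0 // mulrC -ler_pdivrMr //.
  apply: le_trans (_ : L' <= _); last by rewrite expr2 ler_peMl // ltW.
  by rewrite (le_trans _ AL') // !le_max lexx !orbT.
have L'L : L <= L' + 1.
  by have : A <= L' := AL'; rewrite ge_max => /andP[? _]; have := ler_norm L; lra.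
have L'0 : 0 < L' by rewrite (lt_le_trans ltr01).
have psup := plateau_supported L'.
have pb := supported_bounded_continuous psup.
have mp : 1 / 2 <= mean nu (plateau L').
  by move: hL'; rewrite ler_norml => /andP[? ?]; lra.
pose c := mean nu h / mean nu (plateau L').
have hsup' := supported_ge L'L hsup.
pose u x := h x - c * plateau L' x.
have usup : supported_in (L' + 1) u.
  split; first by have [] := bounded_continuousB hb (bounded_continuousZ c pb).
  by move=> x xL; rewrite /u hsup'.2 // psup.2 // mulr0 subrr.
have u0 : mean nu u = 0.
  rewrite meanB ?meanZ //; last exact: bounded_continuousZ.
  by rewrite /c divfK ?subrr // gt_eqF // (lt_le_trans _ mp) // divr_gt0.
have [f [g [df fsup gsup sol]]] := stein_solution s0 usup u0.
have s20 : 0 < s ^+ 2 by rewrite exprn_gt0.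
have Eu : E n u @[n --> \oo] --> (0 : R).
  have : (- (s ^+ 2)^-1) * (E n (fun x => x * f x) - s ^+ 2 * E n g) @[n --> \oo] -->
      (- (s ^+ 2)^-1) * 0.
    by apply: cvgM; [exact: cvg_cst | exact: stein df fsup gsup].
  rewrite mulr0; apply: cvg_trans; apply: near_eq_cvg; apply: nearW => n.
  rewrite -EZ -EB -EZ; congr E; apply/funext => x.
  by rewrite -opprB sol mulrNN mulKf // gt_eqF.
have cm : `|c| <= 2 * m.
  rewrite /c normrM normfV ler_pdivrMr; last by rewrite normr_gt0 gt_eqF // (lt_le_trans _ mp) // divr_gt0.
  by rewrite [X in _ <= _ * X]ger0_norm; [have := ler_wpM2l m0 mp; rewrite -/m; lra | lra].
near=> n.
have c1 : `|0 - E n u| <= e / 4.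
  by near: n; apply: cvgr_dist_le; rewrite ?divr_gt0.
have -> : mean nu h - E n h = (0 - E n u) + c * (mean nu (plateau L') - E n (plateau L')).
  rewrite /u EB EZ mulrBr {2}/c divfK; first by ring.
  by rewrite gt_eqF // (lt_le_trans _ mp) // divr_gt0.
rewrite (le_trans (ler_normD _ _)) // normrM.
have pp : `|mean nu (plateau L') - E n (plateau L')| <= 2 * e'.
  have := tail n L'0; move: hL'; rewrite !ler_norml => /andP[? ?] /andP[? ?].
  by apply/andP; split; lra.
have : `|c| * `|mean nu (plateau L') - E n (plateau L')| <= (2 * m) * (2 * e').
  exact: ler_pM.
lra.
Unshelve. all: by end_near. Qed.

(** Uses [|x| <= a + x ^+ 2 / a]: the choice of [a] makes the constant part [e / 2], and the
    vanishing second moment controls the rest. *)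
Lemma cvg_from_degenerate :
  E n (fun x => x ^+ 2) @[n --> \oo] --> (0 : R) ->
  forall K h, lipschitz K h -> E n h @[n --> \oo] --> h 0.
Proof.
move=> E0 K h hK; apply/cvgrPdist_le => e e0.
have K1 : 0 < `|K| + 1 by rewrite ltr_wpDl.
pose a := e / (2 * (`|K| + 1)).
have a0 : 0 < a by rewrite divr_gt0 // mulr_gt0.
have ae : (`|K| + 1) * a = e / 2 by rewrite /a; field; rewrite gt_eqF.
near=> n.
have c1 : `|0 - E n (fun x => x ^+ 2)| <= a ^+ 2.
  by near: n; apply: cvgr_dist_le => //; rewrite exprn_gt0.
rewrite -[X in `|X - _|](Ecst n) -EB.
apply: le_trans (_ : E n (fun x => (`|K| + 1) * a - (- ((`|K| + 1) / a)) * x ^+ 2) <= _).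
  apply: E_le => x; apply: le_trans (hK 0 x) _; rewrite sub0r normrN.
  apply: le_trans (_ : (`|K| + 1) * `|x| <= _).
    by rewrite ler_wpM2r // (le_trans (ler_norm K)) // lerDl.
  rewrite mulNr opprK -mulrA -mulrDr ler_pM2l //.
  have -> : a + a^-1 * x ^+ 2 = (a ^+ 2 + x ^+ 2) / a by field; rewrite gt_eqF.
  rewrite ler_pdivlMr // -(real_normK (num_real x)).
  by have := sqr_ge0 (a - `|x|); nra.
rewrite EB Ecst EZ mulNr opprK ae.
have -> : (`|K| + 1) / a * E n (fun x => x ^+ 2) = e / 2 / a ^+ 2 * E n (fun x => x ^+ 2).
  by congr (_ * _); rewrite -ae; field; rewrite gt_eqF.
have : e / 2 / a ^+ 2 * E n (fun x => x ^+ 2) <= e / 2.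
  rewrite -[leRHS]mulr1 -mulrA ler_pM2l ?divr_gt0 // mulrC ler_pdivrMr ?exprn_gt0 // mul1r.
  by move: c1; rewrite sub0r normrN => /(le_trans (ler_norm _)).
lra.
Unshelve. all: by end_near. Qed.

End SteinConvergence.

(** * Numerical limits: binomial coefficients, harmonic sums, drift *)

Section NumericLimits.
Variable R : realType.

(** The ratio is a product of [k] factors, truncations at 0 of [(N - g - j) / N] with [j < k], each
    between [1 - (g + k) / N] and 1. *)
Lemma bin_asymptotic g k N : (0 < N)%N ->
  1 - (k * (g + k))%:R / N%:R <= ('C(N - g, k)%:R * k`!%:R / N%:R ^+ k : R) <= 1.
Proof.
move=> N0; have n0 : 0 < N%:R :> R by rewrite ltr0n.
rewrite -natrM bin_ffact.
suff main j : 0 <= (((N - g) ^_ j)%:R / N%:R ^+ j : R) <= 1 /\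
    ((j <= k)%N -> 1 - (j * (g + k))%:R / N%:R <= ((N - g) ^_ j)%:R / N%:R ^+ j :> R).
  by have [/andP[_ ->] ->] := main k.
elim: j => [|j [/andP[P0 P1] IH]].
  by rewrite ffactn0 expr0 divr1 mul0n mul0r subr0 lexx ler01.
rewrite ffactnSr exprSr natrM invfM mulrACA.
set P := _ / _ in P0 P1 IH *; set a : R := (_ - _)%:R / _.
have a0 : 0 <= a by rewrite divr_ge0.
have a1 : a <= 1 by rewrite ler_pdivrMr // mul1r ler_nat; lia.
split; first by rewrite mulr_ge0 // mulr_ile1.
move=> jk; have {}IH := IH (ltnW jk).
have alow : 1 - (g + k)%:R / N%:R <= a.
  rewrite lerBlDr -mulrDl ler_pdivlMr // mul1r -natrD ler_nat; lia.
rewrite mulSn natrD mulrDl.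
have : 0 <= (1 - P) * (1 - a) by rewrite mulr_ge0 // subr_ge0.
lra.
Qed.

Lemma cvg_inv_sqrt : (Num.sqrt n.+1%:R)^-1 @[n --> \oo] --> (0 : R).
Proof.
rewrite -[0 : R]sqrtr0.
have -> : (fun n => (Num.sqrt n.+1%:R)^-1 : R) = (fun n => Num.sqrt (harmonic n)).
  by apply/funext => n; rewrite /harmonic sqrtrV.
by apply: continuous_cvg; [exact: sqrt_continuous | exact: cvg_harmonic].
Qed.

Lemma cvg_bound0 (u : R^nat) (v : R^nat) : (forall n, `|u n| <= v n) ->
  v n @[n --> \oo] --> (0 : R) -> u n @[n --> \oo] --> (0 : R).
Proof.
move=> uv v0; apply/cvgrPdist_le => e e0; near=> n.
rewrite sub0r normrN (le_trans (uv n)) // (le_trans (ler_norm _)) //.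
rewrite -normrN -sub0r; near: n; exact: cvgr_dist_le.
Unshelve. all: by end_near. Qed.

Lemma cvg_cM0 (c : R) (v : R^nat) : v n @[n --> \oo] --> (0 : R) ->
  c * v n @[n --> \oo] --> (0 : R).
Proof. by move=> v0; rewrite -[X in _ --> X](mulr0 c); apply: cvgM => //; exact: cvg_cst. Qed.

Lemma bin_ratio_close g k N : (0 < N)%N ->
  `|'C(N - g, k)%:R / N%:R ^+ k - k`!%:R^-1| <= (k * (g + k))%:R / N%:R :> R.
Proof.
move=> N0; have /andP[h1 h2] := bin_asymptotic g k N0.
have f1 : 1 <= k`!%:R :> R by rewrite ler1n fact_gt0.
have f0 : 0 < k`!%:R :> R by rewrite (lt_le_trans ltr01).
rewrite distrC ger0_norm; last first.
  by rewrite subr_ge0 -[k`!%:R^-1]mul1r ler_pdivlMr // mulrAC.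
rewrite -(ler_pM2r f0) mulrBl mulVf ?gt_eqF // mulrAC.
have c0 : 0 <= (k * (g + k))%:R / N%:R :> R by rewrite divr_ge0.
by have := ler_wpM2l c0 f1; lra.
Qed.

Lemma cvg_bin_sqrt g k :
  Num.sqrt n.+1%:R * ('C(n.+1 - g, k)%:R / n.+1%:R ^+ k - k`!%:R^-1) @[n --> \oo] --> (0 : R).
Proof.
apply: (@cvg_bound0 _ (fun n => (k * (g + k))%:R * (Num.sqrt n.+1%:R)^-1)); last first.
  exact: cvg_cM0 cvg_inv_sqrt.
move=> n; rewrite normrM ger0_norm ?sqrtr_ge0 //.
apply: le_trans (ler_wpM2l _ (bin_ratio_close _ _ _)) _ => //.
have s0 : 0 < Num.sqrt n.+1%:R :> R by rewrite sqrtr_gt0.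
rewrite -{2}[n.+1%:R](@sqr_sqrtr R) // expr2 invfM.
by rewrite mulrCA mulVKf ?gt_eqF.
Qed.

(** For [k < j] the limit is 0. Mere convergence is stated because the limiting variance is not made
    explicit. *)
Lemma cvg_bin_ratio g k j : (k <= j)%N ->
  cvg ('C(n.+1 - g, k)%:R / n.+1%:R ^+ j @[n --> \oo] : set_system R).
Proof.
move=> kj; have cv : 'C(n.+1 - g, k)%:R / n.+1%:R ^+ k @[n --> \oo] --> (k`!%:R^-1 : R).
  apply/subr_cvg0; apply: (@cvg_bound0 _ (fun n => (k * (g + k))%:R * (@harmonic R n))).
    by move=> n; exact: bin_ratio_close.
  exact: cvg_cM0 (@cvg_harmonic R).
have inv : (n.+1%:R ^- (j - k)) @[n --> \oo] --> ((0 : R) ^+ (j - k)).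
  have -> : (fun n => n.+1%:R ^- (j - k) : R) = (fun n => @harmonic R n ^+ (j - k)).
    by apply/funext => n; rewrite exprVn.
  by apply: (@continuous_cvg _ _ _ _ _ (@harmonic R) (fun x : R => x ^+ (j - k)));
    [exact: exprn_continuous | exact: cvg_harmonic].
apply/cvg_ex; exists (k`!%:R^-1 * 0 ^+ (j - k)).
have -> : (fun n => 'C(n.+1 - g, k)%:R / n.+1%:R ^+ j : R) =
    (fun n => 'C(n.+1 - g, k)%:R / n.+1%:R ^+ k * n.+1%:R ^- (j - k)).
  by apply/funext => n; rewrite -mulrA -invfM -exprD subnKC.
exact: cvgM.
Qed.

(** Replaces the logarithm as a bound of the harmonic sum: a power below 1/2 is absorbed by
    [delta = O(1 / sqrt n)]. *)
Definition root4 n : R := Num.sqrt (Num.sqrt n%:R).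

Lemma root4_gt0 n : 0 < root4 n.+1.
Proof. by rewrite !sqrtr_gt0. Qed.

Lemma root4_sqr n : root4 n ^+ 2 = Num.sqrt n%:R.
Proof. by rewrite sqr_sqrtr // sqrtr_ge0. Qed.

Lemma root4_exp4 n : root4 n ^+ 4 = n%:R.
Proof. by rewrite (exprM _ 2 2) root4_sqr sqr_sqrtr. Qed.

(** Telescoping: for consecutive fourth roots, [t ^+ 4 - u ^+ 4 = 1] factors into
    [1 <= (t - u) * (4 * t ^+ 3)], and [t ^+ 3 <= t ^+ 4 = n + 1]. *)
Lemma harmonic_sum_le n : \sum_(j < n) (j.+1%:R^-1 : R) <= 4 * root4 n.
Proof.
elim: n => [|n IHn]; first by rewrite big_ord0 mulr_ge0 // sqrtr_ge0.
rewrite big_ord_recr /=.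
suff h : n.+1%:R^-1 <= 4 * (root4 n.+1 - root4 n).
  by apply: le_trans (lerD IHn h) _; rewrite -mulrDr addrC subrK.
have t0 := root4_gt0 n; have e4 := root4_exp4 n.+1; have e4' := root4_exp4 n.
have u0 : 0 <= root4 n by rewrite sqrtr_ge0.
move: t0 e4 e4' u0; set t := root4 n.+1; set u := root4 n => t0 e4 e4' u0.
have ut : u <= t by rewrite !ler_wsqrtr // ler_nat.
have t1 : 1 <= t.
  by rewrite -{1}(@sqrtr1 R) ler_wsqrtr // -{1}(@sqrtr1 R) ler_wsqrtr // ler1n.
have tu : 0 <= t - u by rewrite subr_ge0.
have d1 : (t - u) * (t ^+ 3 + t ^+ 2 * u + t * u ^+ 2 + u ^+ 3) = 1.
  have -> : (t - u) * (t ^+ 3 + t ^+ 2 * u + t * u ^+ 2 + u ^+ 3) = t ^+ 4 - u ^+ 4 by ring.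
  by rewrite e4 e4' -natr1; ring.
have t00 : 0 <= t by exact: ltW.
have u2 : u ^+ 2 <= t ^+ 2 by rewrite lerXn2r.
have u3 : u ^+ 3 <= t ^+ 3 by rewrite lerXn2r.
have c1 : t ^+ 2 * u <= t ^+ 3 by rewrite [t ^+ 3]exprSr ler_wpM2l ?exprn_ge0.
have c2 : t * u ^+ 2 <= t ^+ 3 by rewrite [t ^+ 3]exprS ler_wpM2l.
have t34 : t ^+ 3 <= t ^+ 4 by rewrite [t ^+ 4]exprS ler_peMl ?exprn_ge0.
rewrite -e4 -[X in X <= _]mul1r ler_pdivrMr ?exprn_gt0 // -[leLHS]d1.
apply: le_trans (_ : (t - u) * (4 * t ^+ 4) <= _); last by rewrite mulrCA mulrA.
by apply: ler_wpM2l => //; lra.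
Qed.

Lemma prod_drift_le (a : R) n : 0 <= a ->
  \prod_(j < n) (1 + a * j.+1%:R^-1) <= expR (4 * a * root4 n).
Proof.
move=> a0; apply: le_trans (_ : expR (\sum_(j < n) a * j.+1%:R^-1) <= _).
  rewrite expR_sum; apply: ler_prod => j _.
  by rewrite expR_ge1Dx andbT addr_ge0 // mulr_ge0 // invr_ge0.
rewrite ler_expR -big_distrr /= -mulrA mulrCA; apply: ler_wpM2l => //.
exact: harmonic_sum_le.
Qed.

Lemma cvg_drift (c : R) : expR (c / root4 n.+1) @[n --> \oo] --> (1 : R).
Proof.
rewrite -[X in _ --> X]expR0.
apply: continuous_cvg; first exact: continuous_expR.
apply: cvg_cM0; have -> : (fun n => (root4 n.+1)^-1) = (fun n => Num.sqrt (Num.sqrt n.+1%:R)^-1).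
  by apply/funext => n; rewrite sqrtrV // sqrtr_ge0.
rewrite -[0 : R]sqrtr0.
by apply: continuous_cvg; [exact: sqrt_continuous | exact: cvg_inv_sqrt].
Qed.

End NumericLimits.

Lemma is_cvg_finsum (R : realType) (I : finType) (P : pred I) (f : I -> nat -> R) :
  (forall i, P i -> cvg (f i n @[n --> \oo])) ->
  cvg (\sum_(i | P i) f i n @[n --> \oo]).
Proof.
move=> cf; elim: (index_enum I) => [|i r IHr].
  rewrite (_ : (fun n => _) = cst 0); first exact: is_cvg_cst.
  by apply/funext => n; rewrite big_nil.
rewrite (_ : (fun n => _) = (if P i then f i else cst 0) \+
    (fun n => \sum_(j <- r | P j) f j n)); last first.
  by apply/funext => n; rewrite big_cons /=; case: (P i); rewrite ?add0r.
by apply: is_cvgD => //; case: ifP => [/cf //|_]; exact: is_cvg_cst.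
Qed.

(** By the mean value theorem, the modulus of continuity of the derivative yields the first-order
    estimate that [dependency_stein] takes as hypothesis. *)
Lemma mvt_close (R : realType) (f g : R -> R) (d eps : R) :
    (forall x, is_derive x (1 : R) f (g x)) ->
    (forall x y, `|x - y| <= d -> `|g x - g y| <= eps) ->
  forall x y, `|x - y| <= d -> `|f x - f y - g x * (x - y)| <= `|x - y| * eps.
Proof.
move=> df hg.
have fc : continuous f.
  by move=> z; apply/differentiable_continuous/derivable1_diffP; have [] := df z.
have mv a b : a <= b -> exists2 c, a <= c <= b & f b - f a = g c * (b - a).
  move=> ab; have [|c] := MVT_segment ab (fun x _ => df x); first exact: continuous_subspaceT.
  by rewrite in_itv /= => cab ->; exists c.
move=> x y xy.
have [c [cx ->]] : exists c, `|x - c| <= `|x - y| /\ f x - f y = g c * (x - y).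
  have [yx|xy'] := leP y x.
    have [c /andP[yc cx] ->] := mv _ _ yx; exists c; split => //.
    by rewrite !ger0_norm ?subr_ge0 // lerB.
  have [c /andP[xc cy] e] := mv _ _ (ltW xy'); exists c; split.
    by rewrite distrC [leRHS]distrC !ger0_norm ?subr_ge0 ?(le_trans xc) // lerD2r.
  by rewrite -[LHS]opprB e -mulrN opprB.
rewrite -mulrBl normrM mulrC; apply: ler_wpM2l => //.
by rewrite distrC; apply: hg; rewrite (le_trans cx).
Qed.

(** * Limit law under the uniform measure *)

Section UniformCLT.
Variables (R : realType) (q : nat) (X : {set 'I_q}) (tau : 'S_q.+1).
Let p := q.+1.
Let e := (q - #|X|)%N.

(** This is [N ^ (e + 1/2)] with [N = n + 1]: division by [N ^ e.+1] followed by multiplication by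
    [sqrt N]. *)
Definition scale n : R := Num.sqrt n.+1%:R * n.+1%:R ^+ e.

Lemma scale_gt0 n : 0 < scale n.
Proof. by rewrite mulr_gt0 ?exprn_gt0 // sqrtr_gt0. Qed.

Lemma scale_sqr n : scale n ^+ 2 = (n.+1 ^ (2 * e).+1)%:R.
Proof.
by rewrite exprMn sqr_sqrtr // -exprM mulnC natrX exprS.
Qed.

Definition unif_law n (h : R -> R) : R :=
  esp (unif R (N := n.+1)) (fun s => h (pattern_sum R X tau s / scale n)).

Lemma unif_law_sqr n :
  unif_law n (fun x => x ^+ 2) =
  esp (unif R (N := n.+1)) (fun s => pattern_sum R X tau s ^+ 2) / scale n ^+ 2.
Proof.
by rewrite mulrC -espZ; apply: eq_esp => s; rewrite exprMn exprVn mulrC.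
Qed.

Lemma unif_law_sqr_le n : unif_law n (fun x => x ^+ 2) <= (p ^ 2)%:R.
Proof.
rewrite unif_law_sqr ler_pdivrMr ?exprn_gt0 ?scale_gt0 // scale_sqr -natrM.
exact: pattern_sum_second_moment.
Qed.

(** Each shape contributes a fixed covariance times a binomial coefficient whose degree is at most
    [2 * e + 1] by [blocks_overlap], and [scale ^+ 2] is exactly this power of [N]. *)
Lemma variance_limit : exists V : R, 0 <= V /\
  unif_law n (fun x => x ^+ 2) @[n --> \oo] --> V.
Proof.
have X_le : (#|X| <= q)%N by rewrite -[X in (_ <= X)%N]card_ord max_card.
have eX : (2 * (q.+1 - #|X|) - 1 = (2 * e).+1)%N by rewrite subSn // mulnS subn1.
have cv : cvg (unif_law n (fun x => x ^+ 2) @[n --> \oo]).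
  rewrite (_ : (fun n => _) = (fun N => \sum_(n < 2 * p)
      \sum_(AB : p.-tuple 'I_n.+1 * p.-tuple 'I_n.+1 | shape_ok X AB)
      pair_esp R tau AB.1 AB.2 * ('C(N.+1 - #|links X AB.1 :|: links X AB.2|,
        n.+1 - #|links X AB.1 :|: links X AB.2|)%:R / N.+1%:R ^+ (2 * e).+1))); last first.
    apply/funext => N; rewrite unif_law_sqr pattern_sum_variance scale_sqr natrX big_distrl /=.
    by apply: eq_bigr => n _; rewrite big_distrl; apply: eq_bigr => AB _; rewrite /= mulrA.
  apply: is_cvg_finsum => n _; apply: is_cvg_finsum => AB /and4P[aA aB mAB /eqP cover].
  apply: is_cvgM; first exact: is_cvg_cst.
  apply: cvg_bin_ratio; have := blocks_overlap aA aB mAB cover.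
  by rewrite eX.
exists (lim (unif_law n (fun x => x ^+ 2) @[n --> \oo])); split => //.
apply: limr_ge => //; apply: nearW => n.
by apply: sumr_ge0 => s _; rewrite mulr_ge0 ?unif_ge0 // sqr_ge0.
Qed.

Lemma unif_lawB n f g : unif_law n (fun x => f x - g x) = unif_law n f - unif_law n g.
Proof. exact: espB. Qed.

Lemma unif_lawZ n c f : unif_law n (fun x => c * f x) = c * unif_law n f.
Proof. exact: espZ. Qed.

Lemma unif_law_cst n c : unif_law n (fun=> c) = c.
Proof. by apply: esp_cst; exact: unif_sum. Qed.

Lemma ler_norm_unif_law n f g : (forall x, `|f x| <= g x) -> `|unif_law n f| <= unif_law n g.
Proof. by move=> fg; apply: ler_norm_esp => //; exact: unif_ge0. Qed.

Lemma unif_law_stein (V : R) : unif_law n (fun x => x ^+ 2) @[n --> \oo] --> V ->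
  forall (L : R) (f g : R -> R), (forall x, is_derive x (1 : R) f (g x)) -> supported_in L f ->
     supported_in L g ->
     unif_law n (fun x => x * f x) - V * unif_law n g @[n --> \oo] --> (0 : R).
Proof.
move=> cvV L f g df fsup gsup.
have [B B0 gB] := supported_bounded gsup.
have first : unif_law n (fun x => x * f x) -
    unif_law n (fun x => x ^+ 2) * unif_law n g @[n --> \oo] --> (0 : R).
  apply/cvgrPdist_le => eta eta0.
  (* After division by [scale ^+ 2] the Stein error is at most [3 * p ^ 2 * eps]. *)
  pose eps := eta / (3 * (p ^ 2)%:R).
  have p20 : 0 < (p ^ 2)%:R :> R by rewrite ltr0n expn_gt0.
  have eps0 : 0 < eps by rewrite divr_gt0 // mulr_gt0.
  have [d d0 hd] := supported_unif_continuous gsup eps0.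
  near=> n.
  (* A neighbourhood weighs [O(N ^ e)] against a scale [N ^ (e + 1/2)], so [g] oscillates by at most
     [eps] at this distance. *)
  have small : 2 * overlap_bound R X n.+1 / scale n <= d.
    have -> : 2 * overlap_bound R X n.+1 / scale n =
        2 * (p ^ 2)%:R * (Num.sqrt n.+1%:R)^-1.
      have -> : overlap_bound R X n.+1 = (p ^ 2)%:R * n.+1%:R ^+ e.
        by rewrite /overlap_bound natrM [X in _ * X = _]natrX.
      have m0 : n.+1%:R ^+ e != 0 :> R by rewrite expf_neq0 // pnatr_eq0.
      have r0 : Num.sqrt n.+1%:R != 0 :> R by rewrite gt_eqF // sqrtr_gt0.
      rewrite /scale; move: m0 r0.
      move: (n.+1%:R ^+ e) (Num.sqrt n.+1%:R) ((p ^ 2)%:R) => m r c m0 r0.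
      by field; rewrite m0 r0.
    near: n; have := cvg_cM0 (2 * (p ^ 2)%:R) (@cvg_inv_sqrt R).
    by move/cvgrPdist_le => /(_ d d0); apply: filterS => n;
      rewrite sub0r normrN; exact: le_trans (ler_norm _).
  have hd' x y : `|x - y| <= 2 * overlap_bound R X n.+1 / scale n -> `|g x - g y| <= eps.
    by move=> /le_trans/(_ small)/hd.
  rewrite sub0r normrN unif_law_sqr.
  have st := @pattern_sum_stein R q X tau n.+1 f g _ _ (scale_gt0 n) (ltW eps0) (mvt_close df hd') hd'.
  apply: le_trans st _.
  rewrite scale_sqr natrM mulrA mulfK; last by rewrite pnatr_eq0 expn_eq0.
  by rewrite /eps mulrC divfK // gt_eqF // mulr_gt0.
have second : (unif_law n (fun x => x ^+ 2) - V) * unif_law n g @[n --> \oo] --> (0 : R).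
  apply: (@cvg_bound0 _ _ (fun n => B * `|unif_law n (fun x => x ^+ 2) - V|)).
    move=> n; rewrite normrM mulrC ler_wpM2r // -[leRHS](unif_law_cst n).
    exact: ler_norm_unif_law.
  apply: cvg_cM0; apply/cvgrPdist_le => eta eta0; near=> n.
  by rewrite sub0r normrN normr_id distrC; near: n; exact: cvgr_dist_le.
have -> : (fun n => unif_law n (fun x => x * f x) - V * unif_law n g) =
    (fun n => unif_law n (fun x => x * f x) - unif_law n (fun x => x ^+ 2) * unif_law n g) \+
    (fun n => (unif_law n (fun x => x ^+ 2) - V) * unif_law n g).
  by apply/funext => n /=; ring.
by rewrite -[X in _ --> X]addr0; exact: cvgD.
Unshelve. all: by end_near. Qed.

Lemma centered_normal_sqr (s : R) : 0 < s ->
  centered_normal (s ^+ 2) = normal_prob 0 s :> probability _ R.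
Proof.
by move=> s0; rewrite /centered_normal ifF ?sqrtr_sqr ?gtr0_norm // expf_eq0 gt_eqF.
Qed.

Lemma mean_centered_normal0 (h : R -> R) : continuous h -> mean (@centered_normal R 0) h = h 0.
Proof.
move=> hc; rewrite /centered_normal eqxx /mean /Rintegral integral_dirac //=.
  by rewrite indicT mul1r.
by apply/measurable_EFinP; exact: continuous_measurable_fun.
Qed.

Lemma unif_law_clt (V : R) : 0 <= V -> unif_law n (fun x => x ^+ 2) @[n --> \oo] --> V ->
  forall (K B : R) (h : R -> R), lipschitz K h -> (forall x, `|h x| <= B) ->
    unif_law n h @[n --> \oo] --> mean (centered_normal V) h.
Proof.
move=> V0 cvV K B h hK hB; have [VE|Vn0] := eqVneq V 0.
  rewrite VE mean_centered_normal0; last exact: lipschitz_continuous hK.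
  apply: (cvg_from_degenerate unif_lawB unif_lawZ unif_law_cst ler_norm_unif_law _ hK).
  by rewrite -[X in _ --> X]VE.
have s0 : 0 < Num.sqrt V by rewrite sqrtr_gt0 lt_def Vn0.
have VE : V = Num.sqrt V ^+ 2 by rewrite sqr_sqrtr.
rewrite VE centered_normal_sqr //.
apply: (cvg_from_supported unif_lawB unif_lawZ unif_law_cst ler_norm_unif_law); last first.
  exact: bounded_lipschitz_continuous hK hB.
apply: (cvg_from_stein unif_lawB unif_lawZ unif_law_cst ler_norm_unif_law unif_law_sqr_le s0).
by rewrite -VE; exact: unif_law_stein.
Qed.

End UniformCLT.

(** * Transfer to the Ewens law *)

Section EwensCLT.
Variables (R : realType) (theta : R) (q : nat) (X : {set 'I_q}) (tau : 'S_q.+1).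
Hypothesis theta_gt0 : 0 < theta.
Hypothesis ewens_sum : forall n, \sum_(s : 'S_n.+1) ewens_weight theta s = 1.
Let p := q.+1.
Let e := (q - #|X|)%N.

Let ew n : 'S_n.+1 -> R := @ewens_weight R theta n.+1.
Let un n := @unif R n.+1.
Let S n (s : 'S_n.+1) : R := pattern_sum R X tau s.

Lemma ewens_weight_ge0 n (s : 'S_n) : 0 <= ewens_weight theta s.
Proof.
rewrite divr_ge0 ?exprn_ge0 ?prodr_ge0 // ?ltW // => i _.
by rewrite addr_ge0 // ltW.
Qed.

(** With [delta = C / sqrt N], the bound [4 * N ^ (1/4)] on the harmonic sum leaves [N ^ (-1/4)] in
    the exponent. *)
Lemma ewens_drift (C : R) n (H : 'S_n.+1 -> R) : 0 <= C -> (forall s, 0 <= H s) ->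
    (forall s t, close_perms s t -> H s <= (1 + C / Num.sqrt n.+1%:R) * H t) ->
  esp (@ew n) H <= expR (4 * C * `|theta - 1| / root4 R n.+1) * esp (@un n) H.
Proof.
move=> C0 H0 Hclose; have sq0 : 0 < Num.sqrt n.+1%:R :> R by rewrite sqrtr_gt0.
have d0 : 0 <= C / Num.sqrt n.+1%:R by rewrite divr_ge0 // ltW.
apply: le_trans (ewens_le_unif theta_gt0 d0 H0 Hclose) _.
apply: ler_wpM2r.
  by apply: sumr_ge0 => s _; rewrite mulr_ge0 // unif_ge0.
under eq_bigr => j _ do rewrite mulrA.
apply: le_trans (prod_drift_le _ _) _; first by rewrite mulr_ge0.
rewrite ler_expR -root4_sqr le_eqVlt; apply/orP; left; apply/eqP.
by field; rewrite gt_eqF // root4_gt0.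
Qed.

Lemma scaled_close n (s t : 'S_n.+1) : close_perms s t ->
  `|S s / scale R X n - S t / scale R X n| <= (3 * p)%:R / Num.sqrt n.+1%:R.
Proof.
move=> /(pattern_sum_close R X tau) st; rewrite -mulrBl normrM.
rewrite (gtr0_norm (_ : 0 < (scale R X n)^-1)) ?invr_gt0 ?scale_gt0 //.
rewrite ler_pdivrMr ?scale_gt0 //; apply: le_trans st _.
rewrite natrM natrX -/e /scale -/e mulrA divfK ?gt_eqF // sqrtr_gt0 //.
Qed.

Definition ewens_law n (h : R -> R) : R := esp (@ew n) (fun s => h (S s / scale R X n)).

Lemma ewens_law_close K B h : lipschitz K h -> (forall x, `|h x| <= B) ->
  ewens_law n h - unif_law X tau n h @[n --> \oo] --> (0 : R).
Proof.
move=> hK hB.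
have B0 : 0 <= B by apply: le_trans (hB 0).
have K0 : 0 <= K by have := hK 0 1; rewrite sub0r normrN normr1 mulr1; exact: le_trans.
pose C := K * (3 * p)%:R.
have C0 : 0 <= C by rewrite mulr_ge0.
pose Q n := expR (4 * C * `|theta - 1| / root4 R n.+1).
have Q1 n : 1 <= Q n.
  rewrite -expR0 ler_expR divr_ge0 ?mulr_ge0 //; exact: ltW (root4_gt0 _ _).
have half g : lipschitz K g -> (forall x, `|g x| <= B) -> forall n,
    ewens_law n g - unif_law X tau n g <= (Q n - 1) * (2 * B + 1).
  move=> gK gB n.
  (* Since [H >= 1], its additive variation [C / sqrt N] between close permutations is also a
     relative one. Its uniform mean is at most [2 * B + 1], the constant of the bound. *)
  pose H (s : 'S_n.+1) := B + 1 + g (S s / scale R X n).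
  have H1 s : 1 <= H s.
    by rewrite /H; have := gB (S s / scale R X n); rewrite ler_norml => /andP[? _]; lra.
  have Hclose s t : close_perms s t -> H s <= (1 + C / Num.sqrt n.+1%:R) * H t.
    move=> /scaled_close st; rewrite mulrDl mul1r.
    have gst := gK (S s / scale R X n) (S t / scale R X n).
    have : K * `|S s / scale R X n - S t / scale R X n| <= C / Num.sqrt n.+1%:R.
      by rewrite /C -mulrA; apply: ler_wpM2l.
    have : C / Num.sqrt n.+1%:R <= C / Num.sqrt n.+1%:R * H t.
      by rewrite ler_peMr // divr_ge0 // sqrtr_ge0.
    by move: gst; rewrite ler_norml /H => /andP[_]; lra.
  have := ewens_drift C0 (fun s => le_trans ler01 (H1 s)) Hclose.
  rewrite espD [in X in _ <= X]espD (esp_cst (ewens_sum n)) (esp_cst (unif_sum R n.+1)).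
  rewrite -/(ewens_law n g) -/(unif_law X tau n g) -/(Q n) => main.
  have uB : unif_law X tau n g <= B.
    rewrite -[leRHS](unif_law_cst X tau n) (le_trans (ler_norm _)) //.
    exact: ler_norm_unif_law.
  have Q0 : 0 <= Q n - 1 by rewrite subr_ge0.
  by have := ler_wpM2l Q0 uB; lra.
apply: (@cvg_bound0 _ _ (fun n => (2 * B + 1) * (Q n - 1))).
  move=> n; rewrite ler_norml; apply/andP; split; last by rewrite mulrC; exact: half.
  (* The lower bound is the upper bound for the opposite function. *)
  pose g x := 0 - h x.
  have gK : lipschitz K g by move=> x y; rewrite /g !sub0r -opprD normrN; exact: hK.
  have gB x : `|g x| <= B by rewrite /g sub0r normrN.
  have := half g gK gB n; rewrite /g unif_lawB unif_law_cst /ewens_law espB.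
  by rewrite (esp_cst (ewens_sum n)); lra.
apply: cvg_cM0; rewrite -[X in _ --> X](subrr 1).
by apply: cvgB; [exact: cvg_drift | exact: cvg_cst].
Qed.

(** The deterministic gap between the exact uniform mean of the normalised count and the limit of
    the statement, multiplied by [sqrt N]. *)
Definition center_shift n : R :=
  Num.sqrt n.+1%:R * ('C(n.+1 - #|X|, e.+1)%:R / n.+1%:R ^+ e.+1 - e.+1`!%:R^-1) / p`!%:R.

Lemma cvg_center_shift : center_shift n @[n --> \oo] --> (0 : R).
Proof.
rewrite /center_shift; under eq_fun do rewrite mulrC.
by apply: cvg_cM0; exact: cvg_bin_sqrt.
Qed.

(** The expectation of [h] at the variable of the limit theorem, for [N = n + 1], computed on
    ['S_n.+1] with Ewens weights. *)
Definition shifted_law n (h : R -> R) : R :=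
  esp (@ew n) (fun s => h (S s / scale R X n + center_shift n)).

(** Two vanishing differences lead to the uniform law: the shift and the change of law. Both are
    controlled for Lipschitz test functions, to which the general case is reduced. *)
Lemma shifted_law_clt (V : R) : 0 <= V ->
    unif_law X tau n (fun x => x ^+ 2) @[n --> \oo] --> V ->
  forall f, bounded_continuous f ->
    shifted_law n f @[n --> \oo] --> mean (centered_normal V) f.
Proof.
move=> V0 cvV.
have LB n f g : shifted_law n (fun x => f x - g x) = shifted_law n f - shifted_law n g.
  exact: espB.
have LZ n c f : shifted_law n (fun x => c * f x) = c * shifted_law n f by exact: espZ.
have Lcst n c : shifted_law n (fun=> c) = c by exact: esp_cst.
have L_le n f g : (forall x, `|f x| <= g x) -> `|shifted_law n f| <= shifted_law n g.
  by move=> fg; apply: ler_norm_esp => // s; exact: ewens_weight_ge0.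
apply: cvg_from_supported => //.
apply: cvg_from_lipschitz => // K B h hK hB.
have K0 : 0 <= K by have := hK 0 1; rewrite sub0r normrN normr1 mulr1; exact: le_trans.
have c1 := unif_law_clt V0 cvV hK hB.
have c2 := ewens_law_close hK hB.
have c3 : shifted_law n h - ewens_law n h @[n --> \oo] --> (0 : R).
  apply: (@cvg_bound0 _ _ (fun n => K * `|center_shift n|)).
    move=> n; rewrite -espB; apply: ler_norm_esp_cst => //.
      by move=> s; exact: ewens_weight_ge0.
    by move=> s; apply: le_trans (hK _ _) _; rewrite addrAC subrr add0r.
  apply: cvg_cM0; apply/cvgrPdist_le => eta eta0; near=> n.
  rewrite sub0r normrN normr_id -normrN -sub0r; near: n.
  by apply: cvgr_dist_le => //; exact: cvg_center_shift.
have -> : (fun n => shifted_law n h) = (fun n => shifted_law n h - ewens_law n h) \+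
    ((fun n => ewens_law n h - unif_law X tau n h) \+ (fun n => unif_law X tau n h)).
  by apply/funext => n /=; ring.
by rewrite -[X in _ --> X]add0r; apply: cvgD => //; rewrite -[X in _ --> X]add0r; apply: cvgD.
Unshelve. all: by end_near. Qed.

(* Adding [sqrt n] to the rescaled sum makes its fourth power vary by a factor
   [1 + O(1 / sqrt n)] only between close permutations, so that the comparison
   with the uniform law loses a bounded factor. *)
Lemma ewens_fourth_moment : exists2 C, 0 <= C & forall n,
  esp (@ew n) (fun s => (S s / n.+1%:R ^+ e.+1) ^+ 4) <= C / n.+1%:R ^+ 2.
Proof.
pose b : R := (3 * p)%:R.
have b0 : 0 <= b by rewrite ler0n.
(* Bounds [A * ((1 + b / A) ^+ 4 - 1)] for every [A >= 1]; here [A] will be [sqrt N]. *)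
pose C := b * (4 + 6 * b + 4 * b ^+ 2 + b ^+ 3).
have C0 : 0 <= C by rewrite mulr_ge0 // !addr_ge0 // ?mulr_ge0 // exprn_ge0.
(* The exponential bounds the drift factor for all [n]. The rest comes from
   [(A + F) ^+ 4 <= 8 * (A ^+ 4 + F ^+ 4)] and the uniform fourth moment bound. *)
pose C1 := expR (4 * C * `|theta - 1|) * (8 * (1 + 8 * (p ^ 6)%:R)).
have C10 : 0 <= C1 by rewrite mulr_ge0 ?expR_ge0 // mulr_ge0 // addr_ge0 // mulr_ge0.
exists C1 => // n.
pose A : R := Num.sqrt n.+1%:R.
have A0 : 0 < A by rewrite sqrtr_gt0.
have A1 : 1 <= A by rewrite -(@sqrtr1 R) ler_wsqrtr // ler1n.
have A2 : A ^+ 2 = n.+1%:R by rewrite sqr_sqrtr.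
have me0 : 0 < n.+1%:R ^+ e :> R by rewrite exprn_gt0.
pose F (s : 'S_n.+1) := `|S s| / n.+1%:R ^+ e.
have F0 s : 0 <= F s by rewrite divr_ge0 // ltW.
pose H s := (A + F s) ^+ 4.
have H0 s : 0 <= H s by rewrite exprn_ge0 // addr_ge0 // ltW.
have Hclose s t : close_perms s t -> H s <= (1 + C / A) * H t.
  move=> st; have Fst : F s <= F t + b.
    rewrite /F ler_pdivrMr // mulrDl divfK ?gt_eqF //.
    have := pattern_sum_close R X tau st; rewrite -/(S s) -/(S t) natrM natrX -/e -/b.
    by have := ler_distD (S t) (S s) 0; rewrite !subr0; lra.
  have At : A <= A + F t by rewrite lerDl.
  have bA : 0 <= b / A by rewrite divr_ge0 // ltW.
  have step : A + F s <= (1 + b / A) * (A + F t).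
    have := ler_wpM2l bA At; rewrite divfK ?gt_eqF //.
    by rewrite mulrDl mul1r; lra.
  apply: le_trans (_ : ((1 + b / A) * (A + F t)) ^+ 4 <= _).
    by rewrite lerXn2r ?nnegrE // ?mulr_ge0 ?addr_ge0 // ltW.
  rewrite exprMn; apply: ler_wpM2r ; first exact: H0.
  have bAb : b / A <= b by rewrite ler_pdivrMr // ler_peMr.
  have -> : (1 + b / A) ^+ 4 = 1 + b / A * (4 + 6 * (b / A) + 4 * (b / A) ^+ 2 + (b / A) ^+ 3).
    by ring.
  rewrite lerD2l /C [leRHS]mulrAC; apply: ler_wpM2l => //.
  have h2 : (b / A) ^+ 2 <= b ^+ 2 by rewrite lerXn2r.
  have h3 : (b / A) ^+ 3 <= b ^+ 3 by rewrite lerXn2r.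
  lra.
have main := ewens_drift C0 H0 Hclose.
have uH : esp (@un n) H <= 8 * (1 + 8 * (p ^ 6)%:R) * n.+1%:R ^+ 2.
  apply: le_trans (_ : esp (@un n) (fun s => 8 * A ^+ 4 +
      8 / n.+1%:R ^+ (4 * e) * S s ^+ 4) <= _).
    apply: le_esp => [s|s]; first exact: unif_ge0.
    have -> : 8 / n.+1%:R ^+ (4 * e) * S s ^+ 4 = 8 * F s ^+ 4.
      have -> : F s ^+ 4 = S s ^+ 4 / n.+1%:R ^+ (4 * e).
        rewrite /F expr_div_n -exprM [(e * 4)%N]mulnC; congr (_ / _).
        by rewrite !(exprM _ 2 2) real_normK // num_real.
      by rewrite -[LHS]mulrA [_^-1 * _]mulrC.
    rewrite /H; have := sqr_ge0 (A - F s); have := sqr_ge0 (A ^+ 2 - F s ^+ 2); set f := F s.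
    move=> h1 h2.
    have : (A + f) ^+ 2 <= 2 * (A ^+ 2 + f ^+ 2) by nra.
    have pos : 0 <= (A + f) ^+ 2 by exact: sqr_ge0.
    move=> h3; have : ((A + f) ^+ 2) ^+ 2 <= (2 * (A ^+ 2 + f ^+ 2)) ^+ 2.
      by rewrite lerXn2r ?nnegrE // (le_trans pos).
    by rewrite -exprM; nra.
  rewrite espD esp_cst ?unif_sum // espZ.
  have := pattern_sum_fourth_moment R X tau n.+1;
  rewrite -/e -/p natrM [X in 8 * (_ * X)]natrX exprD => S4.
  have m4 : 0 < n.+1%:R ^+ (4 * e) :> R by rewrite exprn_gt0.
  have : 8 / n.+1%:R ^+ (4 * e) * esp (@un n) (fun s => S s ^+ 4) <=
      8 / n.+1%:R ^+ (4 * e) * (8 * ((p ^ 6)%:R * (n.+1%:R ^+ (4 * e) * n.+1%:R ^+ 2))).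
    by rewrite ler_wpM2l // divr_ge0 // ltW.
  have -> : 8 / n.+1%:R ^+ (4 * e) * (8 * ((p ^ 6)%:R * (n.+1%:R ^+ (4 * e) * n.+1%:R ^+ 2))) =
      64 * (p ^ 6)%:R * n.+1%:R ^+ 2 :> R.
    by move: (n.+1%:R ^+ (4 * e)) m4 => m m4; field; rewrite gt_eqF.
  have -> : A ^+ 4 = n.+1%:R ^+ 2 by rewrite (exprM _ 2 2) A2.
  lra.
have r1 : 1 <= root4 R n.+1 by rewrite -(@sqrtr1 R) ler_wsqrtr.
have QC : expR (4 * C * `|theta - 1| / root4 R n.+1) <= expR (4 * C * `|theta - 1|).
  rewrite ler_expR ler_pdivrMr ?root4_gt0 // ler_peMr // mulr_ge0 //.
  by rewrite mulr_ge0.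
have n2 : 0 < n.+1%:R ^+ 2 :> R by rewrite exprn_gt0.
rewrite ler_pdivlMr // mulrC.
have -> : n.+1%:R ^+ 2 * esp (@ew n) (fun s => (S s / n.+1%:R ^+ e.+1) ^+ 4) =
    n.+1%:R ^- 2 * esp (@ew n) (fun s => F s ^+ 4).
  rewrite -!espZ; apply: eq_esp => s.
  have -> : F s ^+ 4 = (S s / n.+1%:R ^+ e) ^+ 4.
    by rewrite /F !expr_div_n !(exprM `|_| 2 2) (exprM (S s) 2 2) real_normK // num_real.
  have N0 : n.+1%:R != 0 :> R by rewrite pnatr_eq0.
  rewrite [_ ^+ e.+1]exprS; move: (n.+1%:R ^+ e) me0 N0; move: (n.+1%:R) (S s) => N x m m0 N0.
  by field; rewrite N0 gt_eqF.
rewrite mulrC ler_pdivrMr //.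
apply: le_trans (_ : esp (@ew n) H <= _).
  apply: le_esp => [s|s]; first exact: ewens_weight_ge0.
  by rewrite /H lerXn2r ?nnegrE // ?addr_ge0 ?lerDr // ltW.
apply: le_trans main _; rewrite /C1 -[leRHS]mulrA; apply: ler_pM => //.
by apply: sumr_ge0 => s _; rewrite mulr_ge0 // unif_ge0.
Qed.

End EwensCLT.

(** * From the probability space to finite sums, and almost sure convergence *)

Section FiniteValued.
Variables (R : realType) (d : measure_display) (T : measurableType d).
Variables (P : probability T R) (I : finType) (sigma : T -> I) (w : I -> R).
Hypothesis sigma_meas : forall A : set I, measurable (sigma @^-1` A).
Hypothesis sigma_law : forall i, P (sigma @^-1` [set i]) = (w i)%:E.

Lemma measurable_finite_valued (F : I -> R) : measurable_fun setT (F \o sigma).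
Proof. by move=> _ B _; rewrite setTI comp_preimage; exact: sigma_meas. Qed.

(** The integrand is a finite combination of indicators of the fibres of [sigma]. Only the law of
    this one [sigma] enters, so the joint law may be arbitrary. *)
Lemma integral_finite_valued (F : I -> R) :
  (\int[P]_t (F (sigma t))%:E)%E = (esp w F)%:E.
Proof.
pose g i t := ((F i)%:E * (\1_(sigma @^-1` [set i]) t)%:E)%E.
have gE t : (F (sigma t))%:E = (\sum_(i <- index_enum I) g i t)%E.
  rewrite (bigD1 (sigma t)) //= big1 ?adde0.
    by rewrite /g indicE mem_set // mule1.
  by move=> i it; rewrite /g indicE memNset ?mule0 // => /= e; rewrite e eqxx in it.
have ind_int i : P.-integrable setT (fun t => (\1_(sigma @^-1` [set i]) t)%:E).
  apply/integrableP; split; first exact/measurable_EFinP/measurable_indic.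
  under eq_integral do rewrite gee0_abs ?lee_fin //.
  rewrite integral_indic // setIT; apply: le_lt_trans (probability_le1 P (sigma_meas _)) _.
  exact: ltry.
under eq_integral => t _ do rewrite gE.
rewrite integral_sum //; last by move=> i; exact: integrableZl.
rewrite /esp -sumEFin; apply: eq_bigr => i _.
rewrite integralZl // integral_indic // setIT.
rewrite (_ : (_ * _)%E = ((F i)%:E * (w i)%:E)%E); first by rewrite -EFinM mulrC.
by congr (_ * _)%E; exact: sigma_law.
Qed.

Lemma esp_finite_valued_cst : \sum_i w i = 1.
Proof.
have := integral_finite_valued (fun=> 1); rewrite integral_cst //.
have /= -> := probability_setT P; rewrite mule1 => -[->].
by apply: eq_bigr => i _; rewrite mulr1.
Qed.

End FiniteValued.

Section AlmostSure.
Variables (R : realType) (d : measure_display) (T : measurableType d).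
Variables (P : probability T R).

(** The induction carries the sharper bound [2 - 1 / n], whose increments dominate the terms. *)
Lemma sum_inv_sqr_le n : \sum_(i < n) (i.+1%:R ^- 2 : R) <= 2.
Proof.
case: n => [|n]; first by rewrite big_ord0.
apply: le_trans (_ : 2 - n.+1%:R^-1 <= _); last by rewrite gerBl invr_ge0.
elim: n => [|n IHn]; first by rewrite big_ord_recl big_ord0 /= expr1n invr1; lra.
rewrite big_ord_recr /=; apply: le_trans (lerD IHn (lexx _)) _.
have n0 : 0 < n.+1%:R :> R by rewrite ltr0n.
rewrite -[n.+2%:R]natr1; move: (n.+1%:R) n0 => m m0.
suff : m^-1 - (m + 1)^-1 - (m + 1) ^- 2 >= 0 by lra.
have -> : m^-1 - (m + 1)^-1 - (m + 1) ^- 2 = (m * (m + 1) ^+ 2)^-1.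
  by field; rewrite !gt_eqF // ltr_wpDl // ltW.
by rewrite invr_ge0 mulr_ge0 ?exprn_ge0 ?addr_ge0 // ltW.
Qed.

(** The series of the [G n] has a finite integral, so it is finite almost everywhere and its terms,
    dominated by its tails, vanish. Only the mean of each [G n] enters, whatever their joint law. *)
Lemma ae_cvg0_of_summable (G : nat -> T -> R) (C : R) : 0 <= C ->
    (forall n, measurable_fun setT (G n)) -> (forall n t, 0 <= G n t) ->
    (forall n, (\int[P]_t (G n t)%:E <= (C / n.+1%:R ^+ 2)%:E)%E) ->
  {ae P, forall t, G n t @[n --> \oo] --> (0 : R)}.
Proof.
move=> C0 mG G0 intG.
have mS : measurable_fun setT (fun t => (\sum_(n <oo) (G n t)%:E)%E).
  by apply: ge0_emeasurable_sum => [n t _ _|n _]; [rewrite lee_fin | exact/measurable_EFinP].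
have S0 t : (0 <= \sum_(n <oo) (G n t)%:E)%E by apply: nneseries_ge0 => n _ _; rewrite lee_fin.
have fin_int : P.-integrable setT (fun t => (\sum_(n <oo) (G n t)%:E)%E).
  apply/integrableP; split => //.
  under eq_integral => t _ do rewrite gee0_abs //.
  rewrite integral_nneseries //; last 2 first.
    by move=> n; exact/measurable_EFinP.
    by move=> n t _; rewrite lee_fin.
  apply: le_lt_trans (_ : ((C * 2)%:E < +oo)%E); last exact: ltry.
  apply: lime_le.
    by apply: is_cvg_nneseries => n _ _; apply: integral_ge0 => t _; rewrite lee_fin.
  apply: nearW => n; rewrite big_mkord.
  apply: le_trans (_ : (\sum_(i < n) (C / i.+1%:R ^+ 2)%:E <= _)%E).
    by apply: lee_sum => i _; exact: intG.
  rewrite sumEFin lee_fin -big_distrr /=; apply: ler_wpM2l => //.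
  exact: sum_inv_sqr_le.
have := integrable_ae measurableT fin_int; apply: filterS => t /(_ I) fint.
have tail : (\sum_(i <= n <oo) (G n t)%:E)%E @[i --> \oo] --> 0%E.
  apply: nneseries_tail_cvg => [|n _]; last by rewrite lee_fin.
  by rewrite -ge0_fin_numE.
have cv : (G n t)%:E @[n --> \oo] --> 0%E.
  apply: (@squeeze_cvge _ _ _ _ (cst 0%E) _ (fun i => \sum_(i <= n <oo) (G n t)%:E)%E) => //.
    apply: nearW => n; rewrite lee_fin G0 /=.
    apply: le_trans (_ : (\sum_(n <= i < n.+1) (G i t)%:E <= _)%E); first by rewrite big_nat1.
    by apply: nneseries_lim_ge => k _ _; rewrite lee_fin.
  exact: cvg_cst.
exact: (fine_cvg cv).
Qed.

End AlmostSure.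

(** * Both limits for the number of occurrences *)

Lemma occurrences_sum (R : realType) q (tau : 'S_q.+1) (X : {set 'I_q}) N (s : 'S_N) :
  (occurrences (p := q.+1) tau X s)%:R =
  pattern_sum R X tau s + 'C(N - #|X|, (q - #|X|).+1)%:R / q.+1`!%:R.
Proof.
rewrite -sum_same_order -natr_sum; congr (_%:R).
rewrite /occurrences -sum1_card big_mkcond [RHS]big_mkcond /=.
apply: eq_bigr => l _; rewrite unfold_in /is_occurrence andbA.
rewrite -/(same_order tau s (tnth l)) -/(admissible (m := q.+1) X l).
by case: (admissible _ l); case: same_order.
Qed.

Theorem theorem1p8 (R : realType) (theta : R) (theta_gt0 : 0 < theta)
    (p : nat) (p_gt0 : (0 < p)%N) (tau : 'S_p) (X : {set 'I_p.-1}) :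
  let q := #|X| in
  let limit : R := (p`!%:R * (p - q)`!%:R)^-1 in
  exists V : R, 0 <= V /\
    forall (d : measure_display) (T : measurableType d) (P : probability T R)
      (sigma : forall N : nat, T -> 'S_N),
    (forall N : nat, (0 < N)%N -> ewens_permutation P theta (sigma N)) ->
    let ratio (N : nat) (w : T) : R :=
      (occurrences tau X (sigma N w))%:R / N%:R ^+ (p - q) in
    {ae P, forall w : T, ratio N w @[N --> \oo] --> limit} /\
    cvg_in_distribution P
      (fun (N : nat) (w : T) => Num.sqrt N%:R * (ratio N w - limit))
      (centered_normal V).
Proof.
move: tau X; case: p p_gt0 => // q _ tau X q0 limit.
change {set 'I_q} in X; pose e := (q - #|X|)%N.
have X_le : (#|X| <= q)%N by rewrite -[X in (_ <= X)%N]card_ord max_card.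
have pqE : (q.+1 - q0 = e.+1)%N by rewrite /q0 subSn.
have limitE : limit = (q.+1`!%:R * e.+1`!%:R)^-1 by rewrite /limit pqE.
rewrite pqE; clearbody limit; clear pqE.
(* [V] is the limiting variance under the uniform law; it is fixed before the probability space and
   does not involve [theta]. *)
have [V [V0 cvV]] := variance_limit R X tau.
exists V; split => // d T P sigma ew.
have law n := ew n.+1 isT.
(* The Ewens weights have total mass 1 because they are the law of [sigma n.+1] under the
   probability [P]. *)
have ew_sum n : \sum_(s : 'S_n.+1) ewens_weight theta s = 1.
  exact: esp_finite_valued_cst (law n).1 (law n).2.
have meas n (F : 'S_n -> R) : measurable_fun setT (fun w => F (sigma n w)).
  (* For [N = 0] nothing is assumed about [sigma], but ['S_0] has a single element. *)
  case: n F => [|n] F; last exact: measurable_finite_valued (law n).1 F.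
  rewrite (_ : (fun w => _) = cst (F 1%g)); first exact: measurable_cst.
  by apply/funext => w; congr F; apply/permP => -[].
have normE n w : Num.sqrt n.+1%:R *
    ((occurrences tau X (sigma n.+1 w))%:R / n.+1%:R ^+ e.+1 - limit) =
    pattern_sum R X tau (sigma n.+1 w) / scale R X n + center_shift R X n.
  rewrite limitE (occurrences_sum R) /scale /center_shift -/e [_ ^+ e.+1]exprS.
  have f1 := fact_neq0 R q.+1; have f2 := fact_neq0 R e.+1.
  have a0 : Num.sqrt n.+1%:R != 0 :> R by rewrite gt_eqF // sqrtr_gt0.
  have m0 : n.+1%:R ^+ e != 0 :> R by rewrite expf_neq0 // pnatr_eq0.
  have NE : n.+1%:R = Num.sqrt n.+1%:R ^+ 2 :> R by rewrite sqr_sqrtr.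
  move: (Num.sqrt n.+1%:R) (n.+1%:R ^+ e) NE a0 m0 => a m; move: (n.+1%:R) => N -> a0 m0.
  move: (q.+1`!%:R) (e.+1`!%:R) f1 f2 => u v u0 v0.
  by field; rewrite a0 m0 u0 v0.
have ratioE n w : (occurrences tau X (sigma n.+1 w))%:R / n.+1%:R ^+ e.+1 - limit =
    pattern_sum R X tau (sigma n.+1 w) / n.+1%:R ^+ e.+1 +
    center_shift R X n / Num.sqrt n.+1%:R.
  have a0 : Num.sqrt n.+1%:R != 0 :> R by rewrite gt_eqF // sqrtr_gt0.
  apply: (mulfI a0); rewrite normE mulrDr [_ * (center_shift _ _ _ / _)]mulrC divfK //.
  congr (_ + _); rewrite /scale -/e exprS.
  have m0 : n.+1%:R ^+ e != 0 :> R by rewrite expf_neq0 // pnatr_eq0.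
  have NE : n.+1%:R = Num.sqrt n.+1%:R ^+ 2 :> R by rewrite sqr_sqrtr.
  move: (Num.sqrt n.+1%:R) (n.+1%:R ^+ e) NE a0 m0 => a m; move: (n.+1%:R) => N -> a0 m0.
  by field; rewrite a0 m0.
split; last first.
  split=> [N|f fc fb]; first exact: (meas N (fun s => Num.sqrt N%:R *
     ((occurrences tau X s)%:R / N%:R ^+ e.+1 - limit))).
  (* Only the sizes [n.+1] carry an assumption; dropping the first term does not change the
     limit. *)
  rewrite -cvg_shiftS.
  have fbc : bounded_continuous f.
    split => //; have [B [_ hB]] := fb; exists (B + 1) => x.
    by apply: (hB (B + 1)) => //; rewrite ltrDl.
  have -> : (fun n => \int[P]_w (f (Num.sqrt n.+1%:R *
      ((occurrences tau X (sigma n.+1 w))%:R / n.+1%:R ^+ e.+1 - limit)))%:E)%E =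
      (fun n => (shifted_law theta X tau n f)%:E).
    apply/funext => n; under eq_integral => w _ do rewrite normE.
    exact: (integral_finite_valued (law n).1 (law n).2
      (fun s => f (pattern_sum R X tau s / scale R X n + center_shift R X n))).
  have -> : (\int[centered_normal V]_x (f x)%:E)%E = (mean (centered_normal V) f)%:E.
    rewrite fineK //; apply: integrable_fin_num => //.
    have [_ [B fB]] := fbc; exact: bounded_continuous_integrable fc fB.
  by apply: cvg_EFin; [exact: nearW | exact: shifted_law_clt].
have [C C0 hC] := @ewens_fourth_moment R theta q X tau theta_gt0.
(* The fourth power is nonnegative with mean [O(1 / N ^ 2)], hence summable. *)
pose G n w := (pattern_sum R X tau (sigma n.+1 w) / n.+1%:R ^+ e.+1) ^+ 4.
have aeG : {ae P, forall w, G n w @[n --> \oo] --> (0 : R)}.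
  apply: (ae_cvg0_of_summable C0) => [n|n w|n].
  - exact: (meas n.+1 (fun s => (pattern_sum R X tau s / n.+1%:R ^+ e.+1) ^+ 4)).
  - by rewrite /G (exprM _ 2 2) sqr_ge0.
  - rewrite (integral_finite_valued (law n).1 (law n).2
      (fun s => (pattern_sum R X tau s / n.+1%:R ^+ e.+1) ^+ 4)) lee_fin.
    exact: hC.
apply: filterS aeG => w Gw; rewrite -cvg_shiftS; apply/subr_cvg0.
have -> : (fun n => (occurrences tau X (sigma n.+1 w))%:R / n.+1%:R ^+ e.+1 - limit) =
  (fun n => pattern_sum R X tau (sigma n.+1 w) / n.+1%:R ^+ e.+1) \+
  (fun n => center_shift R X n * (Num.sqrt n.+1%:R)^-1).
  by apply/funext => n; exact: ratioE.
rewrite -[X in _ --> X]addr0; apply: cvgD; last first.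
  rewrite -[X in _ --> X](mulr0 0); apply: cvgM; first exact: cvg_center_shift.
  exact: cvg_inv_sqrt.
apply/cvgrPdist_le => eps eps0; near=> n.
have : `|0 - G n w| <= eps ^+ 4 by near: n; apply: cvgr_dist_le => //; rewrite exprn_gt0.
rewrite sub0r normrN sub0r normrN /G normrX ler_pXn2r // nnegrE ltW.
Unshelve. all: by end_near. Qed.
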